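(* Let $L$ be a finite lattice with an order-convex subset $C$. If every interval of $L$ is either contractible or homotopy equivalent to a sphere, then every interval of the doubling $L[C]$ is either contractible or homotopy equivalent to a sphere. In particular, if $L$ is a finite congruence-normal lattice, then every interval of $L$ is either contractible or homotopy equivalent to a sphere.
   Context: All posets and lattices are finite. The order complex of a poset is the simplicial complex of its chains, and the topology of a poset is that of its order complex. Saying that an interval is contractible or homotopy equivalent to a sphere refers, for $x<y$, to the order complex of the open interval $(x,y)=\{z: x<z<y\}$; the complex $\{\emptyset\}$ (which occurs when $y$ covers $x$) is regarded as the sphere of dimension $-1$. For a subset $C$ of a poset $P$, let $P_{\ge C}=\{x\in P: x\ge c\text{ for some }c\in C\}$. A subset $C$ is order-convex if $x,y\in C$, $x\le y$ imply $[x,y]\subseteq C$. The doubling $P[C]$ of $P$ at an order-convex subset $C$ is the induced subposet of $P\times\{0,1\}$ (product order, $0<1$) on the set $$P[C]=\big((P\setminus P_{\ge C})\cup C\big)\times\{0\}\ \cup\ P_{\ge C}\times\{1\}.$$ If $L$ is a lattice, then $L[C]$ is a lattice. A lattice congruence of $L$ is an equivalence relation respecting the meet and join operations. For a cover relation $x\lessdot y$ in $L$, $\operatorname{Cg}(x,y)$ denotes the smallest lattice congruence of $L$ (with respect to inclusion) in which $x$ and $y$ are equivalent. If $x\in L$ is meet-irreducible, $x^*$ denotes the unique element covering $x$; if $y\in L$ is join-irreducible, $y_*$ denotes the unique element covered by $y$. A lattice $L$ is congruence-normal if for every meet-irreducible $x$ and join-irreducible $y$ in $L$, the equality $\operatorname{Cg}(x,x^*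 )=\operatorname{Cg}(y_*,y)$ implies $x\ngeq y$. *)

(* Defs.v *)
From HB Require Import structures.
From mathcomp Require Import all_boot all_order all_algebra.
From mathcomp Require Import all_classical all_reals.
From mathcomp Require Import topology normedtype.

Set Implicit Arguments.
Unset Strict Implicit.
Unset Printing Implicit Defensive.

Import Order.TTheory GRing.Theory Num.Theory.
Import numFieldNormedType.Exports.

Local Open Scope classical_set_scope.
Local Open Scope order_scope.
Local Open Scope ring_scope.

Section Homotopy.
Variable R : realType.

Definition homotopic (X Y : topologicalType) (f g : X -> Y) : Prop :=
  exists H : X * R -> Y,
    [/\ {within [set u | 0 <= u.2 <= 1], continuous H},
        forall x, H (x, 0) = f x &
        forall x, H (x, 1) = g x].

Definition homotopy_equivalent (X Y : topologicalType) : Prop :=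
  exists (f : X -> Y) (g : Y -> X),
    [/\ continuous f, continuous g,
        homotopic (g \o f) idfun & homotopic (f \o g) idfun].

Definition contractible (X : topologicalType) : Prop :=
  exists x0 : X, homotopic (@idfun X) (fun=> x0).

(* The sphere of dimension n - 1; it is empty for n = 0. *)
Definition unit_sphere (n : nat) : set 'rV[R]_n :=
  [set v | \sum_(i < n) v ord0 i ^+ 2 = 1].
Arguments unit_sphere : clear implicits.

Definition sphere_like (X : topologicalType) : Prop :=
  exists n : nat, homotopy_equivalent X (unit_sphere n).

(* Barycentric coordinates; the empty face does not contribute any point, so
   the realization of [set set0] is empty. *)
Definition realization (V : finType) (K : {set {set V}}) : set {ptws V -> R} :=
  [set t | [/\ forall v, 0 <= t v, \sum_v t v = 1 &
               [set v | t v != 0]%SET \in K]].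

End Homotopy.

Arguments unit_sphere : clear implicits.
Arguments realization R {V} K.

Section Posets.
Variables (d : Order.disp_t) (P : finPOrderType d).

Definition chain (s : {set P}) : bool :=
  [forall x in s, forall y in s, (x >=< y)%O].

(* The order complex of the subposet of P induced on A. *)
Definition order_complex (A : {set P}) : {set {set P}} :=
  [set s : {set P} | (s \subset A) && chain s]%SET.

Definition open_interval (x y : P) : {set P} := [set z | (x < z < y)%O]%SET.

Definition intervals_contractible_or_spherical (R : realType) : Prop :=
  forall x y : P, (x < y)%O ->
    let I := realization R (order_complex (open_interval x y)) in
    contractible R I \/ sphere_like R I.

Definition order_convex (C : {set P}) : Prop :=
  forall x y z : P, x \in C -> y \in C -> (x <= z <= y)%O -> z \in C.

Definition upset (C : {set P}) : {set P} :=
  [set x | [exists c in C, (c <= x)%O]]%SET.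

Definition doubling_set (C : {set P}) : {set P *p bool} :=
  finset.setX (~: upset C :|: C)%SET [set false]%SET
  :|: finset.setX (upset C) [set true]%SET.

Definition doubling (C : {set P}) : Type :=
  {u : P *p bool | u \in doubling_set C}.

Definition covers (x y : P) : Prop :=
  (x < y)%O /\ forall z : P, ~~ (x < z < y)%O.

End Posets.

Arguments intervals_contractible_or_spherical {d} P R.

HB.instance Definition _ d (P : finPOrderType d) (C : {set P}) :=
  SubFinite.on (doubling C).
HB.instance Definition _ d (P : finPOrderType d) (C : {set P}) :=
  [SubChoice_isSubPOrder of doubling C by <: with d].

Section Lattices.
Variables (d : Order.disp_t) (L : finLatticeType d).

Definition lattice_congruence (E : set (L * L)) : Prop :=
  [/\ forall x, E (x, x),
      forall x y, E (x, y) -> E (y, x),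
      forall x y z, E (x, y) -> E (y, z) -> E (x, z),
      forall x x' y y', E (x, x') -> E (y, y') ->
        E (Order.meet x y, Order.meet x' y') &
      forall x x' y y', E (x, x') -> E (y, y') ->
        E (Order.join x y, Order.join x' y')].

Definition Cg (x y : L) : set (L * L) :=
  smallest lattice_congruence [set (x, y)].

Definition meet_irreducible (x : L) : Prop :=
  (exists z, (x < z)%O) /\
  forall a b : L, x = Order.meet a b -> x = a \/ x = b.

Definition join_irreducible (y : L) : Prop :=
  (exists z, (z < y)%O) /\
  forall a b : L, y = Order.join a b -> y = a \/ y = b.

(* xs and yl are x^* and y_*, the unique upper cover of x and the unique lower
   cover of y. *)
Definition congruence_normal : Prop :=
  forall x xs y yl : L,
    meet_irreducible x -> covers x xs ->
    join_irreducible y -> covers yl y ->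
    Cg x xs = Cg yl y -> ~~ (y <= x)%O.

End Lattices.

Arguments congruence_normal {d} L.

(* Main.v *)
Require Import Defs.
From HB Require Import structures.
From mathcomp Require Import all_boot all_order all_algebra.
From mathcomp Require Import all_classical all_reals.
From mathcomp Require Import topology normedtype realfun.
From mathcomp Require Import ring lra.

Set Implicit Arguments.
Unset Strict Implicit.
Unset Printing Implicit Defensive.

Import Order.TTheory GRing.Theory Num.Theory.
Import numFieldNormedType.Exports.

Local Open Scope classical_set_scope.
Local Open Scope order_scope.
Local Open Scope ring_scope.

(** The proof treats doublings and congruences by order theory and reduces the
    topology to suspensions.

    Doublings. Write the elements of the doubling of P at C as pairs (z, i). An
    open interval whose ends have the same second coordinate is isomorphic to
    an open interval of P. Let the ends be (x, 0) and (y, 1). If x = y the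
    interval is empty, a sphere of dimension -1. If x and y both lie in C, then
    so does all of [x, y], and the interval is [x, y] x {0, 1} without its
    bottom and top; its order complex is the suspension of that of (x, y). If
    just one of x and y lies in C, the interval retracts conically: every
    element lies below its copy at level 1, and this copy lies above (x, 1), or
    dually with (y, 0). If neither lies in C, every element (z, i) lies below
    (z, j), where j = 1 exactly when z is above C, and these elements form a
    copy of (x, y). So each interval of the doubling is contractible or has the
    homotopy type of an interval of P or of its suspension
    ([doubling_intervals]).

    Topology. Everything rests on one explicit formula. A point of the order
    complex of P distributes a unit of mass on a chain; [upper_share] moves the
    topmost part of the mass, of total amount l, from level 0 to level 1 of
    P x {0, 1}, and the result is again carried by a chain. Letting l run from
    0 to 1 gives the homotopy between two comparable order-preserving maps
    ([homotopic_realization_map]), and, after adding a cone at either end, it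
    presents the interval of the prism as a suspension ([prism_suspension]).
    Suspensions are handled through a compact space of meridians: when the base
    is compact and the suspension is Hausdorff, maps and homotopies out of the
    suspension are the same as compatible families along the meridians, so
    suspending preserves homotopy equivalences
    ([suspension_homotopy_equivalent]). The suspension of a sphere is a sphere
    and that of a contractible space is contractible.

    Congruence-normal lattices. The quotient of L by a congruence E is the set
    of least elements of the E-classes, with the order of L. One shows by
    induction, from the full congruence downwards, that all these posets have
    the required intervals; the trivial congruence gives L. If E is not full,
    choose a cover a < b outside E with Cg(a, b) as small as possible and let F
    be the join of E and Cg(a, b). A cover contracted by a join of two
    congruences is contracted by one of them, so all covers in F but not in E
    generate the same congruence. Two pairs v1 < w1 and v2 < w2 in F but not in
    E then cannot satisfy w1 <= v2: there would be a join-irreducible below w1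
    and a meet-irreducible above v2 generating the same congruence, against
    congruence-normality ([step_not_le]). It follows that each class of F splits
    into at most two classes of E, that the classes that do split form an
    order-convex set, and that the quotient by E is the doubling of the quotient
    by F at this set ([step_intervals]). *)

(** * Continuity *)

Section Continuity.
Variable R : realType.

Lemma continuous_compose (X Y Z : topologicalType) (f : X -> Y) (g : Y -> Z) :
  continuous f -> continuous g -> continuous (fun x => g (f x)).
Proof. by move=> cf cg x; apply: (@continuous_comp _ _ _ f g x (cf x) (cg _)). Qed.

Lemma continuous_pair (X Y Z : topologicalType) (f : X -> Y) (g : X -> Z) :
  continuous f -> continuous g -> continuous (fun x => (f x, g x)).
Proof. by move=> cf cg x; apply: cvg_pair; [apply: cf|apply: cg]. Qed.

Lemma continuous_fst (X Y : topologicalType) : continuous (@fst X Y).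
Proof. by move=> [x y]; apply: cvg_fst. Qed.

Lemma continuous_snd (X Y : topologicalType) : continuous (@snd X Y).
Proof. by move=> [x y]; apply: cvg_snd. Qed.

Lemma continuous_const (X Y : topologicalType) (y : Y) :
  continuous (fun _ : X => y).
Proof. by move=> x; apply: cvg_cst. Qed.

Lemma continuous_val (X : topologicalType) (A : set X) :
  continuous (fun x : A => val x).
Proof. exact: (@initial_continuous A X set_val). Qed.

Lemma continuous_into_subtype (T X : topologicalType) (A : set X) (f : T -> A) :
  continuous (fun t => val (f t)) -> continuous f.
Proof.
move=> /continuousP cf; apply/continuousP => B [C oC <-].
exact: (cf C oC).
Qed.

Lemma continuous_into_ptws (T Y : topologicalType) (V : eqType)
    (f : T -> {ptws V -> Y}) :
  (forall v, continuous (fun t => f t v)) -> continuous f.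
Proof.
move=> cf t; apply/cvg_sup.
move=> v B [C [[D oD <-] Dft] DB].
by apply: (filterS DB); apply: (cf v t); apply: open_nbhs_nbhs.
Qed.

Lemma continuous_eval (Y : topologicalType) (V : eqType) (v : V) :
  continuous (fun f : {ptws V -> Y} => f v).
Proof. exact: (@proj_continuous V (fun=> Y) v). Qed.

Section RealValued.
Variable X : topologicalType.
Implicit Types f g : X -> R.

Lemma continuous_addr f g :
  continuous f -> continuous g -> continuous (fun x => f x + g x).
Proof. by move=> cf cg x; apply: cvgD; [apply: cf|apply: cg]. Qed.

Lemma continuous_oppr f : continuous f -> continuous (fun x => - f x).
Proof. by move=> cf x; apply: cvgN; apply: cf. Qed.

Lemma continuous_subr f g :
  continuous f -> continuous g -> continuous (fun x => f x - g x).
Proof. by move=> cf cg; apply: continuous_addr => //; apply: continuous_oppr. Qed.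

Lemma continuous_mulr f g :
  continuous f -> continuous g -> continuous (fun x => f x * g x).
Proof. by move=> cf cg x; apply: cvgM; [apply: cf|apply: cg]. Qed.

Lemma continuous_minr f g :
  continuous f -> continuous g -> continuous (fun x => Num.min (f x) (g x)).
Proof. by move=> cf cg x; apply: continuous_min; [apply: cf|apply: cg]. Qed.

Lemma continuous_maxr f g :
  continuous f -> continuous g -> continuous (fun x => Num.max (f x) (g x)).
Proof. by move=> cf cg x; apply: continuous_max; [apply: cf|apply: cg]. Qed.

Lemma continuous_sumr (I : finType) (P : pred I) (F : I -> X -> R) :
  (forall i, continuous (F i)) -> continuous (fun x => \sum_(i | P i) F i x).
Proof.
move=> cF x; apply: cvg_big => [|i _]; last exact: cF.
exact: add_continuous.
Qed.

End RealValued.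
End Continuity.

(** * Homotopies over the compact segment *)

Definition unit_segment (R : realType) : set R := [set r | 0 <= r <= 1].
Arguments unit_segment : clear implicits.

Section UnitSegment.
Variable R : realType.
Local Notation I := (unit_segment R).

Lemma clamp_subproof (r : R) : Num.max 0 (Num.min 1 r) \in I.
Proof. by rewrite inE /unit_segment /= le_max lexx ge_max ler01 ge_min lexx. Qed.

(** Retracting the line onto the segment turns homotopies that are continuous
    only over the segment into globally continuous ones, and back. *)
Definition clamp (r : R) : I := exist (fun x => x \in I) _ (clamp_subproof r).

Lemma continuous_clamp : continuous clamp.
Proof.
apply: continuous_into_subtype => /=.
apply: (@continuous_maxr R R); first exact: continuous_const.
apply: continuous_minr; first exact: continuous_const.
by move=> x; apply: cvg_id.
Qed.

Lemma segment_bounds (s : I) : 0 <= val s <= 1.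
Proof. by case: s => s /=; rewrite inE. Qed.

Lemma val_clamp (r : R) : 0 <= r <= 1 -> val (clamp r) = r.
Proof. by case/andP=> r0 r1 /=; rewrite (min_idPr r1) (max_idPr r0). Qed.

Lemma clampK (s : I) : clamp (val s) = s.
Proof. by apply: val_inj; rewrite val_clamp // segment_bounds. Qed.

Lemma clamp0 : val (clamp 0) = 0.
Proof. by rewrite val_clamp // lexx ler01. Qed.

Lemma clamp1 : val (clamp 1) = 1.
Proof. by rewrite val_clamp // lexx ler01. Qed.

Lemma continuous_clamp_comp (X : topologicalType) (f : X -> R) :
  continuous f -> continuous (fun x => clamp (f x)).
Proof. by move=> cf; apply: continuous_compose cf continuous_clamp. Qed.

(** Both sides carry the same data: restrict the parameter to the segment, or
    extend it by the retraction of the line. Over the segment the domain of a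
    homotopy is a product of spaces, compact when the first factor is. *)
Lemma homotopicP (X Y : topologicalType) (f g : X -> Y) :
  homotopic R f g <->
  exists H : X * I -> Y, [/\ continuous H, forall x, H (x, clamp 0) = f x &
                             forall x, H (x, clamp 1) = g x].
Proof.
split=> [[H [/subspace_sigL_continuousP cH H0 H1]]|[H [cH H0 H1]]].
  have HA (u : X * I) : (u.1, val u.2) \in [set u : X * R | 0 <= u.2 <= 1].
    by rewrite inE /= segment_bounds.
  pose j u : [set u : X * R | 0 <= u.2 <= 1] :=
    exist (fun u => u \in [set u : X * R | 0 <= u.2 <= 1]) _ (HA u).
  have cj : continuous j.
    apply: continuous_into_subtype => /=; apply: continuous_pair.
      exact: continuous_fst.
    by apply: continuous_compose (@continuous_snd _ _) (@continuous_val _ _).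
  exists (fun u => H (u.1, val u.2)); split=> [|x|x].
  - exact: (continuous_compose cj cH).
  - by rewrite [val _]clamp0.
  - by rewrite [val _]clamp1.
exists (fun u => H (u.1, clamp u.2)); split => //.
apply: continuous_subspaceT; apply: continuous_compose cH.
apply: continuous_pair; first exact: continuous_fst.
by apply: continuous_clamp_comp; apply: continuous_snd.
Qed.

Lemma homotopic_refl (X Y : topologicalType) (f : X -> Y) :
  continuous f -> homotopic R f f.
Proof.
move=> cf; apply/homotopicP; exists (fun u => f u.1); split=> //.
exact: continuous_compose (@continuous_fst _ _) cf.
Qed.

Lemma homotopic_sym (X Y : topologicalType) (f g : X -> Y) :
  homotopic R f g -> homotopic R g f.
Proof.
move=> /homotopicP[H [cH H0 H1]]; apply/homotopicP.
exists (fun u => H (u.1, clamp (1 - val u.2))); split => [|x|x].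
- apply: continuous_compose cH; apply: continuous_pair.
    exact: continuous_fst.
  apply: continuous_clamp_comp; apply: continuous_subr.
    exact: continuous_const.
  exact: continuous_compose (@continuous_snd _ _) (@continuous_val _ _).
- by rewrite [val _]clamp0 subr0 H1.
- by rewrite [val _]clamp1 subrr H0.
Qed.

Lemma homotopic_trans (X Y : topologicalType) (f g h : X -> Y) :
  homotopic R f g -> homotopic R g h -> homotopic R f h.
Proof.
move=> /homotopicP[H [cH H0 H1]] /homotopicP[K [cK K0 K1]]; apply/homotopicP.
pose F (u : X * I) := H (u.1, clamp (2 * val u.2)).
pose G (u : X * I) := K (u.1, clamp (2 * val u.2 - 1)).
have cval : continuous (fun u : X * I => val u.2).
  exact: continuous_compose (@continuous_snd _ _) (@continuous_val _ _).
have c2val : continuous (fun u : X * I => 2 * val u.2).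
  by apply: continuous_mulr cval; apply: continuous_const.
have cF : continuous F.
  apply: continuous_compose cH; apply: continuous_pair.
    exact: continuous_fst.
  exact: continuous_clamp_comp.
have cG : continuous G.
  apply: continuous_compose cK; apply: continuous_pair.
    exact: continuous_fst.
  apply: continuous_clamp_comp; apply: continuous_subr => //.
  exact: continuous_const.
exists (fun u => if val u.2 <= 2^-1 then F u else G u); split=> [|x|x].
- pose A := [set u : X * I | val u.2 <= 2^-1].
  pose B := [set u : X * I | 2^-1 <= val u.2].
  have cA : closed A.
    by apply: (closed_comp _ (@closed_le R 2^-1)) => u _; apply: cval.
  have cB : closed B.
    by apply: (closed_comp _ (@closed_ge R 2^-1)) => u _; apply: cval.
  have AB : A `|` B = setT.
    apply/seteqP; split=> // u _; rewrite /A /B /=.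
    by case/orP: (le_total (val u.2) 2^-1); [left|right].
  apply/continuous_subspace_setT; rewrite -AB.
  apply: withinU_continuous => //.
    apply: (@subspace_eq_continuous _ A _ F); last exact: continuous_subspaceT.
    move=> u; rewrite inE => Au.
    by rewrite -[RHS]/(if val u.2 <= 2^-1 then F u else G u) Au.
  apply: (@subspace_eq_continuous _ B _ G); last exact: continuous_subspaceT.
  move=> u; rewrite inE => Bu.
  rewrite -[RHS]/(if val u.2 <= 2^-1 then F u else G u); case: ifP => // Au.
  have uE : val u.2 = 2^-1 by apply/eqP; rewrite eq_le Au.
  by rewrite /G /F uE divff ?pnatr_eq0 // subrr K0 H1.
- by rewrite [val (x, clamp 0).2]clamp0 ifT ?invr_ge0 // /F clamp0 mulr0 H0.
- rewrite [val (x, clamp 1).2]clamp1 ifF; last by lra.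
  by rewrite /G clamp1 (_ : 2 * 1 - 1 = 1) ?K1 //; lra.
Qed.

Lemma homotopic_comp (W X Y Z : topologicalType) (k : W -> X) (f g : X -> Y)
    (h : Y -> Z) :
  continuous k -> continuous h -> homotopic R f g ->
  homotopic R (fun w => h (f (k w))) (fun w => h (g (k w))).
Proof.
move=> ck ch /homotopicP[H [cH H0 H1]]; apply/homotopicP.
exists (fun u => h (H (k u.1, u.2))); split=> [|w|w]; rewrite ?H0 ?H1 //.
apply: continuous_compose ch; apply: continuous_compose cH.
apply: continuous_pair; last exact: continuous_snd.
exact: continuous_compose (@continuous_fst _ _) ck.
Qed.

Lemma homotopy_equivalent_trans (X Y Z : topologicalType) :
  homotopy_equivalent R X Y -> homotopy_equivalent R Y Z ->
  homotopy_equivalent R X Z.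
Proof.
move=> [f [f' [cf cf' f'f ff']]] [g [g' [cg cg' g'g gg']]].
exists (g \o f), (f' \o g'); split.
- exact: continuous_compose cf cg.
- exact: continuous_compose cg' cf'.
- apply: homotopic_trans f'f.
  exact: (homotopic_comp cf cf' g'g).
- apply: homotopic_trans gg'.
  exact: (homotopic_comp cg' cg ff').
Qed.

Lemma contractible_homotopy_equivalent (X Y : topologicalType) :
  homotopy_equivalent R X Y -> contractible R Y -> contractible R X.
Proof.
move=> [f [g [cf cg gf fg]]] [y0 Hy0]; exists (g y0).
apply: homotopic_trans (homotopic_sym gf) _.
exact: (homotopic_comp cf cg Hy0).
Qed.

Lemma sphere_like_homotopy_equivalent (X Y : topologicalType) :
  homotopy_equivalent R X Y -> sphere_like R Y -> sphere_like R X.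
Proof.
by move=> XY [n Yn]; exists n; apply: homotopy_equivalent_trans XY Yn.
Qed.

Lemma contractible_homotopy_equivalent_point (X : topologicalType) :
  contractible R X -> exists x0 : X, homotopy_equivalent R X [set x0].
Proof.
move=> [x0 Hx0]; exists x0.
have mem0 : x0 \in [set x0] by rewrite inE.
exists (fun=> exist (fun x => x \in [set x0]) x0 mem0), (fun y => val y); split.
- exact: continuous_const.
- exact: continuous_val.
- exact: homotopic_sym.
- have -> : ((fun=> exist (fun x => x \in [set x0]) x0 mem0) \o (fun y : [set x0] => val y)) = idfun.
    apply/funext => y; apply: val_inj => /=.
    by case: y => y /=; rewrite inE => ->.
  by apply: homotopic_refl => x; apply: cvg_id.
Qed.

Lemma contractible_segment : contractible R I.
Proof.
exists (clamp 0); apply/homotopicP.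
exists (fun u => clamp ((1 - val u.2) * val u.1)); split=> [|s|s].
- apply: continuous_clamp_comp; apply: continuous_mulr.
    apply: continuous_subr; first exact: continuous_const.
    exact: continuous_compose (@continuous_snd _ _) (@continuous_val _ _).
  exact: continuous_compose (@continuous_fst _ _) (@continuous_val _ _).
- by rewrite [val (s, _).2]clamp0 subr0 mul1r clampK.
- by rewrite [val (s, _).2]clamp1 subrr mul0r.
Qed.

End UnitSegment.

(** * Compact and Hausdorff types *)

Lemma compact_subtype (X : topologicalType) (A : set X) :
  compact A -> compact [set: A].
Proof.
move=> cA F FF _.
have [|p [Ap pF]] := cA ((fun x : A => val x) @ F).
  apply: (@filterS _ F _ setT); last exact: filterT.
  by move=> [x /= xA] _; exact: set_mem.
exists (exist (fun x => x \in A) p (mem_set Ap)); split=> // G B FG [C [[D oD <-] Dp] DB].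
have [x [[y Gy <-] Dy]] : ((fun x : A => val x) @` G) `&` D !=set0.
  apply: (pF ((fun x : A => val x) @` G)); last exact: open_nbhs_nbhs.
  by apply: (@filterS _ F _ G) => // y Gy; exists y.
by exists y; split=> //; apply: DB.
Qed.

Lemma hausdorff_injective (X Y : topologicalType) (f : X -> Y) :
  continuous f -> injective f -> hausdorff_space Y -> hausdorff_space X.
Proof.
move=> cf fI hY p q pq; apply: fI; apply: hY => A B pA qB.
by have [x [fA fB]] := pq _ _ (cf p A pA) (cf q B qB); exists (f x).
Qed.

Lemma hausdorff_subtype (X : topologicalType) (A : set X) :
  hausdorff_space X -> hausdorff_space A.
Proof. exact: hausdorff_injective (@continuous_val _ _) val_inj. Qed.

Lemma hausdorff_prod (X Y : topologicalType) :
  hausdorff_space X -> hausdorff_space Y -> hausdorff_space (X * Y)%type.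
Proof.
move=> hX hY [p1 p2] [q1 q2] pq; congr (_, _).
  apply: hX => A B pA qB.
  have [] := pq _ _ (@continuous_fst _ Y (p1, p2) A pA)
                    (@continuous_fst _ Y (q1, q2) B qB).
  by move=> [x y] [? ?]; exists x.
apply: hY => A B pA qB.
have [] := pq _ _ (@continuous_snd X _ (p1, p2) A pA)
                  (@continuous_snd X _ (q1, q2) B qB).
by move=> [x y] [? ?]; exists y.
Qed.

Lemma compact_prod (X Y : topologicalType) :
  compact [set: X] -> compact [set: Y] -> compact [set: X * Y].
Proof. by move=> cX cY; rewrite -setXTT; apply: compact_setX. Qed.

Lemma compact_unit_segment (R : realType) : compact [set: unit_segment R].
Proof.
apply: compact_subtype.
rewrite (_ : unit_segment R = `[0, 1]%classic); first exact: segment_compact.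
by apply/seteqP; split=> r; rewrite /unit_segment /= in_itv.
Qed.

Lemma hausdorff_unit_segment (R : realType) : hausdorff_space (unit_segment R).
Proof. exact: (hausdorff_subtype (@Rhausdorff R)). Qed.

(** * Suspensions *)

(** A suspension of [X] is presented by its meridians. The conditions say that
    the map from the cylinder identifies its two ends to points and nothing
    else; the poles are listed separately so that the suspension of the empty
    space is a pair of points. The latitude separates the points of a meridian
    from one another and from the poles. *)
Record suspension (R : realType) (X Z : topologicalType) := Suspension {
  meridian : X * unit_segment R -> Z;
  south : Z;
  north : Z;
  latitude : Z -> R;
  meridian_continuous : continuous meridian;
  latitude_south : latitude south = 0;
  latitude_north : latitude north = 1;
  latitude_meridian : forall x s, latitude (meridian (x, s)) = val s;
  meridian_inj : forall x x' s,
    0 < val s < 1 -> meridian (x, s) = meridian (x', s) -> x = x';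
  meridian_south : forall x, meridian (x, clamp 0) = south;
  meridian_north : forall x, meridian (x, clamp 1) = north;
  meridian_cover : forall z,
    [\/ z = south, z = north |
        exists x s, 0 < val s < 1 /\ z = meridian (x, s)]
}.

Section Suspension.
Variable R : realType.
Local Notation I := (unit_segment R).

Lemma segment_cases (s : I) : [\/ s = clamp 0, s = clamp 1 | 0 < val s < 1].
Proof.
have [s0|s0] := eqVneq (val s) 0; first by apply: Or31; rewrite -s0 clampK.
have [s1|s1] := eqVneq (val s) 1; first by apply: Or32; rewrite -s1 clampK.
by apply: Or33; rewrite !lt_neqAle s1 eq_sym s0 segment_bounds.
Qed.

(** The map is forced on each meridian, and the identifications in the source
    are respected in the target. For continuity, the preimage of a closed set
    is the image of a compact subset of the cylinder times [T], together with
    closed sets over the poles; images of compact sets are closed because the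
    suspension is Hausdorff. The parameter space [T] makes the same statement
    cover maps and homotopies. *)
Lemma suspension_functor (X Y Z W T : topologicalType)
    (sX : suspension R X Z) (sY : suspension R Y W) (A : X * T -> Y) :
  compact [set: X] -> compact [set: T] ->
  hausdorff_space Z -> hausdorff_space T -> continuous A ->
  exists B : Z * T -> W, [/\ continuous B,
    forall t, B (south sX, t) = south sY, forall t, B (north sX, t) = north sY &
    forall x s t, B (meridian sX (x, s), t) = meridian sY (A (x, t), s)].
Proof.
move=> cX cT hZ hT cA.
have sn : north sX <> south sX.
  move=> /(congr1 (latitude sX)); rewrite latitude_south latitude_north.
  by move/eqP; rewrite oner_eq0.
have /choice[B BP] : forall u : Z * T, exists b : W,
    [/\ u.1 = south sX -> b = south sY, u.1 = north sX -> b = north sY &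
     forall x s, 0 < val s < 1 -> u.1 = meridian sX (x, s) ->
       b = meridian sY (A (x, u.2), s)].
  case=> z t /=.
  case: (meridian_cover sX z) => [->|->|[x [s [s01 ->]]]].
  - exists (south sY); split=> // [/esym //|x s s01 /(congr1 (latitude sX))].
    by rewrite latitude_south latitude_meridian => s0; rewrite -s0 ltxx in s01.
  - exists (north sY); split=> // x s s01 /(congr1 (latitude sX)).
    rewrite latitude_north latitude_meridian => s1.
    by rewrite -s1 ltxx andbF in s01.
  - exists (meridian sY (A (x, t), s)); split.
    + move=> /(congr1 (latitude sX)).
      by rewrite latitude_south latitude_meridian => s0; rewrite s0 ltxx in s01.
    + move=> /(congr1 (latitude sX)).
      rewrite latitude_north latitude_meridian => s1.
      by rewrite s1 ltxx andbF in s01.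
    + move=> x' s' s01' e; have es : s = s'.
        apply: val_inj; move/(congr1 (latitude sX)): e.
        by rewrite !latitude_meridian.
      by subst s'; rewrite (meridian_inj s01 e).
have B0 t : B (south sX, t) = south sY by case: (BP (south sX, t)) => ->.
have B1 t : B (north sX, t) = north sY by case: (BP (north sX, t)) => _ ->.
have BM x s t : B (meridian sX (x, s), t) = meridian sY (A (x, t), s).
  case: (segment_cases s) => [->|->|s01].
  - by rewrite !meridian_south.
  - by rewrite !meridian_north.
  - by case: (BP (meridian sX (x, s), t)) => _ _ /(_ x s s01 erefl).
exists B; split=> //; apply/continuous_closedP => C cC.
pose q (v : (X * I) * T) := (meridian sX v.1, v.2).
pose h (v : (X * I) * T) := meridian sY (A (v.1.1, v.2), v.1.2).
have cq : continuous q.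
  apply: continuous_pair; last exact: continuous_snd.
  exact: continuous_compose (@continuous_fst _ _) (@meridian_continuous _ _ _ sX).
have ch : continuous h.
  apply: continuous_compose (@meridian_continuous _ _ _ sY).
  apply: continuous_pair; last first.
    exact: continuous_compose (@continuous_fst _ _) (@continuous_snd _ _).
  apply: continuous_compose cA; apply: continuous_pair.
    exact: continuous_compose (@continuous_fst _ _) (@continuous_fst _ _).
  exact: continuous_snd.
have hZT := hausdorff_prod hZ hT.
(* The part of the preimage that lies on the meridians. *)
have cim : closed (q @` (h @^-1` C)).
  apply: compact_closed => //; apply: continuous_compact.
    exact: continuous_subspaceT.
  apply: (@subclosed_compact _ _ setT) => //.
    by move/continuous_closedP: ch; apply.
  by do !apply: compact_prod => //; exact: compact_unit_segment.
have cpole (p : Z) (b : W) : closed [set u : Z * T | u.1 = p /\ C b].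
  have [Cb|nCb] := pselect (C b); last first.
    rewrite (_ : [set _ | _] = set0); first exact: closed0.
    by apply/seteqP; split=> // u [].
  rewrite (_ : [set _ | _] = fst @^-1` [set p]); last first.
    by apply/seteqP; split=> u //= [].
  move/continuous_closedP: (@continuous_fst Z T); apply.
  by apply: accessible_closed_set1; apply: hausdorff_accessible.
rewrite (_ : B @^-1` C = q @` (h @^-1` C) `|`
  ([set u | u.1 = south sX /\ C (south sY)] `|`
   [set u | u.1 = north sX /\ C (north sY)])); last first.
  apply/seteqP; split=> [[z t] /=|[z t]].
    case: (meridian_cover sX z) => [->|->|[x [s [s01 ->]]]].
    - by rewrite B0 => ?; right; left.
    - by rewrite B1 => ?; right; right.
    - by rewrite BM => ?; left; exists ((x, s), t).
  case=> [[[[x s] t'] /= Ch [<- <-]]|[]/= [-> Cp]].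
  - by rewrite BM.
  - by rewrite B0.
  - by rewrite B1.
by apply: closedU => //; apply: closedU.
Qed.

(** Suspend both maps and both homotopies meridian by meridian. *)
Lemma suspension_homotopy_equivalent (X Y Z W : topologicalType)
    (sX : suspension R X Z) (sY : suspension R Y W) :
  compact [set: X] -> compact [set: Y] ->
  hausdorff_space Z -> hausdorff_space W ->
  homotopy_equivalent R X Y -> homotopy_equivalent R Z W.
Proof.
move=> kX kY hZ hW [f [g [cf cg gf fg]]].
have kI := @compact_unit_segment R; have hI := @hausdorff_unit_segment R.
have ext X' Y' Z' W' (sX' : suspension R X' Z') (sY' : suspension R Y' W') f' :
  compact [set: X'] -> hausdorff_space Z' -> continuous f' ->
  exists F : Z' -> W', [/\ continuous F, F (south sX') = south sY',
    F (north sX') = north sY' &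
    forall x s, F (meridian sX' (x, s)) = meridian sY' (f' x, s)].
  move=> kX' hZ' cf'.
  have [|B [cB B0 B1 BM]] := suspension_functor sX' sY' kX' kI hZ' hI
    (A := fun u => f' u.1).
    exact: continuous_compose (@continuous_fst _ _) cf'.
  exists (fun z => B (z, clamp 0)); split=> //.
  apply: continuous_compose cB; apply: continuous_pair.
    by move=> ?; apply: cvg_id.
  exact: continuous_const.
have [F [cF F0 F1 FM]] := ext _ _ _ _ sX sY f kX hZ cf.
have [G [cG G0 G1 GM]] := ext _ _ _ _ sY sX g kY hW cg.
have loop X' Z' (sX' : suspension R X' Z') f' F' :
  compact [set: X'] -> hausdorff_space Z' -> homotopic R f' idfun ->
  F' (south sX') = south sX' -> F' (north sX') = north sX' ->
  (forall x s, F' (meridian sX' (x, s)) = meridian sX' (f' x, s)) ->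
  homotopic R F' idfun.
  move=> kX' hZ' /homotopicP[H [cH H0 H1]] F'0 F'1 F'M.
  have [B [cB B0 B1 BM]] := suspension_functor sX' sX' kX' kI hZ' hI cH.
  apply/homotopicP; exists B; split=> // z.
    case: (meridian_cover sX' z) => [->|->|[x [s [_ ->]]]].
    - by rewrite B0 F'0.
    - by rewrite B1 F'1.
    - by rewrite BM F'M H0.
  case: (meridian_cover sX' z) => [->|->|[x [s [_ ->]]]].
  - by rewrite B0.
  - by rewrite B1.
  - by rewrite BM H1.
exists F, G; split=> //.
- apply: (loop _ _ sX _ _ kX hZ gf) => [||x s] /=.
  + by rewrite F0 G0.
  + by rewrite F1 G1.
  + by rewrite FM GM.
- apply: (loop _ _ sY _ _ kY hW fg) => [||x s] /=.
  + by rewrite G0 F0.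
  + by rewrite G1 F1.
  + by rewrite GM FM.
Qed.

(** The segment is its own single meridian. *)
Definition point_suspension (X : topologicalType) (x0 : X) :
  suspension R [set x0] I.
Proof.
apply: (@Suspension R [set x0] I (fun u => u.2) (clamp 0) (clamp 1)
  (fun s => val s)) => //.
- exact: continuous_snd.
- exact: clamp0.
- exact: clamp1.
- move=> [x /= xP] [y /= yP] _ _ _; apply: val_inj => /=.
  by move: xP yP; rewrite !inE => -> ->.
- move=> s; case: (segment_cases s) => [->|->|s01]; first exact: Or31.
    exact: Or32.
  by apply: Or33; exists (exist (fun x => x \in [set x0]) x0 (mem_set erefl)), s.
Defined.

(** The suspension of a point is a segment. *)
Lemma suspension_contractible (X Z : topologicalType) (sX : suspension R X Z) :
  compact [set: X] -> hausdorff_space Z -> contractible R X ->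
  contractible R Z.
Proof.
move=> kX hZ /contractible_homotopy_equivalent_point[x0 Xx0].
apply: contractible_homotopy_equivalent (contractible_segment R).
apply: (suspension_homotopy_equivalent sX (point_suspension x0)) => //.
  by apply: compact_subtype; exact: compact_set1.
exact: hausdorff_unit_segment.
Qed.

End Suspension.

(** * Spheres *)

Section Spheres.
Variable R : realType.
Local Notation I := (unit_segment R).
Local Notation sphere n := (unit_sphere R n).

Lemma continuous_into_row (T : topologicalType) n (f : T -> 'rV[R]_n) :
  (forall j, continuous (fun t => f t ord0 j)) -> continuous f.
Proof.
move=> cf t A [P fP PA]; apply: (filterS PA).
apply: filter_forall => i; apply: filter_forall => j.
by rewrite (ord1 i); exact: (cf j t _ (fP ord0 j)).
Qed.

Lemma continuous_sqrt_comp (T : topologicalType) (f : T -> R) :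
  continuous f -> continuous (fun t => Num.sqrt (f t)).
Proof. by move=> cf; apply: continuous_compose cf (@sqrt_continuous R). Qed.

Lemma compact_sphere n : compact [set: sphere n].
Proof.
apply: compact_subtype.
have cube : compact [set v : 'rV[R]_n | forall i, `[-1, 1]%classic (v ord0 i)].
  by apply: (@rV_compact R n (fun=> `[-1, 1]%classic)) => i; exact: segment_compact.
apply: subclosed_compact cube _.
  pose sq (v : 'rV[R]_n) := \sum_(i < n) v ord0 i ^+ 2.
  apply: (@preimage_closed _ _ sq [set x | x = 1]); last exact: closed_eq.
  move=> v _; apply: (@continuous_sumr R 'rV[R]_n) => i.
  by apply: continuous_mulr; exact: coord_continuous.
move=> v /= v1 i; rewrite in_itv /= -ler_norml.
rewrite -(@ler_sqr R) ?nnegrE ?normr_ge0 ?ler01 // real_normK ?num_real //.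
rewrite expr1n -v1 (bigD1 i) //= lerDl.
by apply: sumr_ge0 => j _; exact: sqr_ge0.
Qed.

Lemma hausdorff_sphere n : hausdorff_space (sphere n).
Proof. exact: (hausdorff_subtype (@norm_hausdorff R 'rV[R]_n)). Qed.

Definition stack n (c : R) (u : 'rV[R]_n) : 'rV[R]_n.+1 :=
  \row_j if unlift ord0 j is Some k then u ord0 k else c.

Lemma stack0 n c (u : 'rV[R]_n) : stack c u ord0 ord0 = c.
Proof. by rewrite mxE unlift_none. Qed.

Lemma stackS n c (u : 'rV[R]_n) k : stack c u ord0 (lift ord0 k) = u ord0 k.
Proof. by rewrite mxE liftK. Qed.

Lemma stack_sphere n c (u : 'rV[R]_n) :
  c ^+ 2 + \sum_i u ord0 i ^+ 2 = 1 -> stack c u \in sphere n.+1.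
Proof.
move=> cu1; rewrite inE /unit_sphere /= big_ord_recl stack0.
by under eq_bigr do rewrite stackS.
Qed.

Definition sphere_stack n c (u : 'rV[R]_n) cu1 : sphere n.+1 :=
  exist (fun v => v \in sphere n.+1) (stack c u) (@stack_sphere n c u cu1).

Lemma sphere_sum n (u : sphere n) : \sum_i val u ord0 i ^+ 2 = 1.
Proof. by case: u => u /=; rewrite inE. Qed.

Lemma parallel_subproof n (u : sphere n) (s : I) :
  let c := 2 * val s - 1 in
  c ^+ 2 + \sum_i (Num.sqrt (1 - c ^+ 2) *: val u) ord0 i ^+ 2 = 1.
Proof.
move=> c; under eq_bigr do rewrite mxE exprMn.
rewrite -mulr_sumr sphere_sum mulr1 sqr_sqrtr; first by rewrite addrC subrK.
have /andP[s0 s1] := segment_bounds s.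
by rewrite /c; nra.
Qed.

Lemma pole_subproof n (c : R) :
  c ^+ 2 = 1 -> c ^+ 2 + \sum_i (0 : 'rV[R]_n) ord0 i ^+ 2 = 1.
Proof. by move=> c1; rewrite big1 ?addr0 // => i _; rewrite mxE expr0n. Qed.

(** The meridian through a point of the equator is drawn at height [2 s - 1],
    where the parallel has radius [sqrt (1 - (2 s - 1) ^+ 2)]. *)
Definition sphere_suspension n : suspension R (sphere n) (sphere n.+1).
Proof.
pose pole c (c1 : c ^+ 2 = 1) := sphere_stack (pole_subproof n c1).
have m1 : (- 1 : R) ^+ 2 = 1 by rewrite sqrrN expr1n.
apply: (@Suspension R (sphere n) (sphere n.+1)
  (fun us => sphere_stack (parallel_subproof us.1 us.2))
  (pole (-1) m1) (pole 1 (expr1n _ _))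
  (fun v => (val v ord0 ord0 + 1) / 2)).
- apply: continuous_into_subtype => /=; apply: continuous_into_row => j.
  have cc : continuous (fun us : sphere n * I => 2 * val us.2 - 1).
    apply: continuous_subr; last exact: continuous_const.
    apply: continuous_mulr; first exact: continuous_const.
    exact: continuous_compose (@continuous_snd _ _) (@continuous_val _ _).
  case: (unliftP ord0 j) => [k|] ->; last first.
    by under eq_fun do rewrite stack0.
  under eq_fun do rewrite stackS mxE.
  apply: continuous_mulr.
    apply: continuous_sqrt_comp; apply: continuous_subr.
      exact: continuous_const.
    exact: continuous_mulr.
  apply: continuous_compose (@coord_continuous _ _ _ ord0 k).
  exact: continuous_compose (@continuous_fst _ _) (@continuous_val _ _).
- by rewrite /= stack0 addNr mul0r.
- by rewrite /= stack0; lra.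
- by move=> u s; rewrite /= stack0; lra.
- move=> u u' s s01 /(congr1 val) /= /rowP e; apply: val_inj; apply/rowP => k.
  move: (e (lift ord0 k)); rewrite !stackS !mxE; apply: mulfI.
  rewrite sqrtr_eq0 -ltNge; case/andP: s01 => s0 s1.
  rewrite (_ : 1 - _ = 4 * (val s * (1 - val s))); last by move=> /=; ring.
  by rewrite mulr_gt0 // mulr_gt0 // subr_gt0.
- move=> u; apply: val_inj => /=; rewrite [Num.max _ _]clamp0.
  apply/rowP => j; case: (unliftP ord0 j) => [k|] ->.
    by rewrite !stackS !mxE mulr0 sub0r sqrrN expr1n subrr sqrtr0 mul0r.
  by rewrite !stack0 mulr0 sub0r.
- move=> u; apply: val_inj => /=; rewrite [Num.max _ _]clamp1.
  apply/rowP => j; case: (unliftP ord0 j) => [k|] ->.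
    rewrite !stackS !mxE (_ : 2 * 1 - 1 = 1 :> R); last lra.
    by rewrite expr1n subrr sqrtr0 mul0r.
  by rewrite !stack0; lra.
- move=> v; pose c := val v ord0 ord0.
  pose w : 'rV[R]_n := \row_k val v ord0 (lift ord0 k).
  have vE : val v = stack c w.
    apply/rowP => j; case: (unliftP ord0 j) => [k|] ->.
      by rewrite stackS mxE.
    by rewrite stack0.
  have cw : c ^+ 2 + \sum_k w ord0 k ^+ 2 = 1.
    rewrite -(sphere_sum v) big_ord_recl; congr (_ + _).
    by apply: eq_bigr => k _; rewrite mxE.
  have w_ge0 k : true -> 0 <= w ord0 k ^+ 2 by move=> _; exact: sqr_ge0.
  have sw_ge0 : 0 <= \sum_k w ord0 k ^+ 2 by exact: sumr_ge0.
  have [c1|c1] := eqVneq (c ^+ 2) 1.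
    have w0 : w = 0.
      have sw0 : \sum_k w ord0 k ^+ 2 = 0 by lra.
      apply/rowP => k; rewrite [RHS]mxE; apply/eqP.
      by rewrite -sqrf_eq0 (psumr_eq0P w_ge0 sw0).
    have: (c == 1) || (c == -1) by rewrite -eqf_sqr expr1n; apply/eqP.
    by case/orP => /eqP ec; [apply: Or32|apply: Or31]; apply: val_inj;
      rewrite vE w0 ec.
  have r_gt0 : 0 < 1 - c ^+ 2 by rewrite subr_gt0 lt_neqAle c1 /=; lra.
  have s01 : 0 <= (c + 1) / 2 <= 1 by nra.
  have s01' : 0 < (c + 1) / 2 < 1 by nra.
  pose r := Num.sqrt (1 - c ^+ 2).
  have r2 : r ^+ 2 = 1 - c ^+ 2 by rewrite sqr_sqrtr // ltW.
  have r0 : r != 0 by rewrite sqrtr_eq0 -ltNge.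
  have uP : r^-1 *: w \in sphere n.
    rewrite inE /unit_sphere /=; under eq_bigr do rewrite mxE exprMn.
    rewrite -mulr_sumr exprVn r2 (_ : \sum_k _ = 1 - c ^+ 2); last by lra.
    by rewrite mulVf // gt_eqF.
  apply: Or33; exists (exist (fun u => u \in sphere n) _ uP), (clamp ((c + 1) / 2)).
  split; first by rewrite val_clamp.
  apply: val_inj; rewrite [RHS]/= [Num.max _ _](@val_clamp R) //.
  rewrite (_ : 2 * _ - 1 = c) ?vE; last lra.
  by rewrite -/r scalerA mulfV // scale1r.
Defined.

End Spheres.

(** * Realizations of order complexes *)

Section Realization.
Variable R : realType.

Section OnePoset.
Variables (d : Order.disp_t) (P : finPOrderType d).
Implicit Types (A : {set P}) (t : P -> R).

Definition order_realization A : set {ptws P -> R} :=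
  realization R (order_complex A).

Lemma order_realizationP A t : order_realization A t <->
  [/\ forall z, 0 <= t z, \sum_z t z = 1, forall z, t z != 0 -> z \in A &
      forall z w, t z != 0 -> t w != 0 -> (z >=< w)%O].
Proof.
split=> [[t0 t1]|[t0 t1 tA tch]].
  rewrite !inE => /andP[/fintype.subsetP sA /forall_inP ch]; split=> // [z|z w] tz.
    by apply: sA; rewrite inE.
  move=> tw; have /ch/forall_inP : z \in [set v | t v != 0]%SET by rewrite inE.
  by apply; rewrite inE.
split=> //; rewrite !inE; apply/andP; split.
  by apply/fintype.subsetP => z; rewrite inE; exact: tA.
apply/forall_inP => z; rewrite inE => tz; apply/forall_inP => w.
by rewrite inE; exact: tch.
Qed.

Lemma order_realization_prop A (t : order_realization A) :
  order_realization A (val t).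
Proof. by case: t => t /=; rewrite inE. Qed.

Lemma continuous_weight A z :
  continuous (fun t : order_realization A => val t z).
Proof.
exact: (continuous_compose (@continuous_val _ (order_realization A))
                           (@continuous_eval R P z)).
Qed.

(** A closed subset of a cube: the points carried by a fixed chain satisfy
    closed conditions, and there are finitely many chains. *)
Lemma compact_order_realization A : compact [set: order_realization A].
Proof.
apply: compact_subtype.
have cube : compact [set t : {ptws P -> R} | forall z, `[0, 1]%classic (t z)].
  by apply: (@tychonoff P (fun=> R) (fun=> `[0, 1]%classic)) => z; exact: segment_compact.
apply: subclosed_compact cube _; last first.
  move=> t /order_realizationP[t0 t1 _ _] z /=.
  rewrite in_itv /= t0 /= -t1 (bigD1 z) //= lerDl.
  by apply: sumr_ge0 => w _; exact: t0.
rewrite (_ : order_realization A =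
  [set t : {ptws P -> R} | forall z, 0 <= t z] `&`
  [set t : {ptws P -> R} | \sum_z t z = 1] `&`
  \bigcup_(s in [set s | s \in order_complex A])
     [set t : {ptws P -> R} | forall z, z \notin s -> t z = 0]); last first.
  apply/seteqP; split=> [t [t0 t1 ts]|t [[t0 t1]]].
    split=> //; exists [set z | t z != 0]%SET => // z.
    by rewrite inE negbK => /eqP.
  move=> [s /= sA ts]; apply/order_realizationP.
  have tP z : t z != 0 -> z \in s.
    by move=> tz; apply: contraT => /ts /eqP; rewrite (negbTE tz).
  move: sA; rewrite inE => /andP[/fintype.subsetP sA /forall_inP ch].
  split=> // [z /tP /sA //|z w /tP zs /tP ws].
  by have /forall_inP := ch _ zs; apply.
apply: closedI; first apply: closedI.
- rewrite (_ : [set _ | _] = \bigcap_(z in [set: P])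
    ((fun t : {ptws P -> R} => t z) @^-1` [set r | 0 <= r])); last first.
    by apply/seteqP; split=> t h z; [move=> _|]; exact: h.
  apply: closed_bigI => z _.
  apply: preimage_closed; last exact: closed_ge.
  by move=> t _; exact: continuous_eval.
- apply: (@preimage_closed _ _ (fun t : {ptws P -> R} => \sum_z t z) [set x | x = 1]);
    last exact: closed_eq.
  by move=> t _; apply: (@continuous_sumr R {ptws P -> R}) => z; exact: continuous_eval.
- apply: closed_bigcup => [|s _]; first exact: finite_finset.
  rewrite (_ : [set _ | _] = \bigcap_(z in [set z : P | z \notin s])
    ((fun t : {ptws P -> R} => t z) @^-1` [set r | r = 0])); last first.
    by apply/seteqP; split=> t h z; exact: h.
  apply: closed_bigI => z _.
  apply: preimage_closed; last exact: closed_eq.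
  by move=> t _; exact: continuous_eval.
Qed.

Lemma hausdorff_order_realization A : hausdorff_space (order_realization A).
Proof.
apply: hausdorff_subtype.
exact: (@hausdorff_product P (fun=> R) (fun=> @Rhausdorff R)).
Qed.

Lemma order_realization_vertex A c :
  c \in A -> order_realization A (fun z => (z == c)%:R).
Proof.
move=> cA; apply/order_realizationP; split=> [z||z|z w].
- exact: ler0n.
- by rewrite (bigD1 c) //= eqxx big1 ?addr0 // => z /negbTE ->.
- by case: (z =P c) => [->|]; rewrite ?eqxx.
- case: (z =P c) => [->|]; rewrite ?eqxx // => _.
  by case: (w =P c) => [->|]; rewrite ?eqxx // comparablexx.
Qed.

Lemma order_realization_vertexP A t c :
  order_realization A t -> t c = 1 -> t = (fun z => (z == c)%:R).
Proof.
move=> /order_realizationP[t0 t1 _ _] tc; apply/funext => z.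
case: (z =P c) => [->//|/eqP zc]; apply/eqP; rewrite eq_le t0 andbT mulr0n.
rewrite (bigD1 c) //= (bigD1 z) //= tc in t1.
have : 0 <= \sum_(w | (w != c) && (w != z)) t w by exact: sumr_ge0.
by lra.
Qed.

(** The part of the mass of [t] at [z] that lies among the topmost [l] units
    of mass, where [t] is carried by a chain and the mass is counted from the
    top of the chain downwards. *)
Definition upper_share t (l : R) (z : P) : R :=
  Num.min (t z) (Num.max 0 (l - \sum_(w | (z < w)%O) t w)).

Section UpperShare.
Variables (t : P -> R) (l : R).
Hypothesis t_ge0 : forall z, 0 <= t z.
Local Notation above z := (\sum_(w | (z < w)%O) t w).

Lemma above_ge0 z : 0 <= above z.
Proof. exact: sumr_ge0. Qed.

Lemma upper_share_ge0 z : 0 <= upper_share t l z.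
Proof. by rewrite /upper_share le_min t_ge0 le_max lexx. Qed.

Lemma upper_share_le z : upper_share t l z <= t z.
Proof. by rewrite /upper_share ge_min lexx. Qed.

Lemma upper_share_eq0 z : t z = 0 -> upper_share t l z = 0.
Proof. by move=> tz; apply/eqP; rewrite eq_le upper_share_ge0 -{1}tz upper_share_le. Qed.

Lemma upper_share_low z : l <= 0 -> upper_share t l z = 0.
Proof.
move=> l0; rewrite /upper_share (_ : Num.max _ _ = 0) ?(min_idPr (t_ge0 z)) //.
by apply/max_idPl; rewrite subr_le0 (le_trans l0) ?above_ge0.
Qed.

Lemma upper_share_high z : \sum_w t w <= l -> upper_share t l z = t z.
Proof.
move=> tl; apply/min_idPl; rewrite le_max lerBrDr; apply/orP; right.
apply: le_trans tl; rewrite addrC [leRHS](bigID (fun w => (z < w)%O)) /= lerD2l.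
by rewrite [leRHS](bigD1 z) ?ltxx //= lerDl; exact: sumr_ge0.
Qed.

Hypothesis t_chain : forall z w, t z != 0 -> t w != 0 -> (z >=< w)%O.

(** Taking the topmost mass empties an element before it touches those below,
    so whatever is left lies below whatever is taken. *)
Lemma upper_share_split z w :
  t z - upper_share t l z != 0 -> upper_share t l w != 0 -> (z <= w)%O.
Proof.
move=> tz tw.
have tz0 : t z != 0.
  by apply: contraNneq tz => tz; rewrite upper_share_eq0 // tz subrr.
have tw0 : t w != 0 by apply: contraNneq tw => /upper_share_eq0 ->.
have /orP[//|wz] := t_chain tz0 tw0.
have [->//|zw] := eqVneq z w.
have {}wz : (w < z)%O by rewrite lt_neqAle eq_sym zw.
case/eqP: tz; apply/eqP; rewrite subr_eq0 eq_sym; apply/eqP.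
have lw : above w < l.
  rewrite ltNge; apply: contra tw => lw.
  rewrite /upper_share (_ : Num.max _ _ = 0) ?(min_idPr (t_ge0 w)) //.
  by apply/max_idPl; rewrite subr_le0.
apply/min_idPl; rewrite le_max lerBrDr; apply/orP; right.
apply: le_trans (ltW lw).
rewrite [leRHS](bigD1 z) //= lerD2l [leRHS](bigID (fun v => (z < v)%O)) /=.
rewrite [X in _ <= X + _](eq_bigl (fun v => (z < v)%O)) => [|v].
  by rewrite lerDl sumr_ge0.
case zv: (z < v)%O; rewrite ?andbF // andbT.
by rewrite (lt_trans wz zv) gt_eqF.
Qed.

(** By induction on up-closed sets [U], the amount taken inside [U] is the
    smaller of [l] and the mass of [U]: adding a minimal element [z] to [U]
    adds the amount that the definition prescribes at [z], since all mass of
    [U] lies strictly above [z]. *)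
Lemma upper_share_sum : 0 <= l <= \sum_z t z -> \sum_z upper_share t l z = l.
Proof.
case/andP=> l0 l1.
suff H n (U : {set P}) : #|U| = n ->
    (forall z w, z \in U -> (z <= w)%O -> w \in U) ->
    \sum_(z in U) upper_share t l z = Num.min l (\sum_(z in U) t z).
  rewrite (eq_bigl (mem [set: P]%SET)) => [|z]; last by rewrite !inE.
  rewrite (H _ _ erefl) => [|z w _ _]; last by rewrite !inE.
  by apply/min_idPl; rewrite (eq_bigl xpredT) // => z; rewrite inE.
elim: n U => [|n IH] U cU upU.
  by rewrite (cards0_eq cU) !big_set0 (min_idPr l0).
have [z0 z0U] : exists z0, z0 \in U by apply/card_gt0P; rewrite cU.
have [z zU zmin] : exists2 z, z \in U & forall w, w \in U -> ~~ (w < z)%O.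
  case: (@arg_minnP _ z0 (mem U) (fun w => #|[set v in U | (v < w)%O]|) z0U) => z zU zmin.
  exists z => // w wU; apply/negP => wz.
  have := zmin w wU; rewrite leqNgt => /negP; apply.
  apply: proper_card; apply/properP; split.
    by apply/fintype.subsetP => v; rewrite !inE => /andP[-> /lt_trans->].
  by exists w; rewrite inE wU ?wz ?ltxx.
rewrite (big_setD1 z) //= (big_setD1 z zU) /= IH; last 2 first.
- by move: cU; rewrite (cardsD1 z) zU => -[].
- move=> v w; rewrite !inE => /andP[vz vU] vw; rewrite (upU v w) // andbT.
  by apply: contraNneq (zmin v vU) => wz; rewrite lt_neqAle vz -wz.
have [tz|tz] := eqVneq (t z) 0; first by rewrite upper_share_eq0 // tz !add0r.
(* The mass of [U] without [z] lies strictly above [z], by minimality of [z]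
   and because the mass is on a chain. *)
have -> : \sum_(w in U :\ z) t w = above z.
  rewrite [RHS](bigID (mem (U :\ z)%SET)) /= [X in _ = _ + X]big1 ?addr0 => [|w].
    rewrite [LHS](bigID (fun w => (z < w)%O)) /= [X in _ + X]big1 ?addr0 => [|w].
      by apply: eq_bigl => w; rewrite andbC.
    case/andP; rewrite !inE => /andP[wz wU] zw; apply/eqP; apply: contraNT zw.
    move=> tw; have /orP[] := t_chain tz tw; first by rewrite lt_neqAle eq_sym wz.
    by move=> wz'; have := zmin w wU; rewrite lt_neqAle wz wz'.
  case/andP => zw; rewrite !inE (upU z) ?(ltW zw) // andbT negbK => /eqP wz.
  by rewrite wz ltxx in zw.
rewrite /upper_share; have := above_ge0 z; move: (above z) (t z) (t_ge0 z) l0.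
move=> a b b0 l0 a0.
by rewrite /Num.min /Num.max; do ?case: ifP; lra.
Qed.

End UpperShare.
(** If all of [a] lies above all of [b], then [a] is the topmost part of [a +
    b]. *)
Lemma upper_share_recover (a b : P -> R) z :
  (forall z, 0 <= a z) -> (forall z, 0 <= b z) ->
  (forall z w, b z != 0 -> a w != 0 -> (z <= w)%O) ->
  upper_share (fun w => a w + b w) (\sum_w a w) z = a z.
Proof.
move=> a0 b0 ba; rewrite /upper_share.
have above_a w : a z != 0 -> (z < w)%O -> a w + b w = a w.
  move=> az zw; suff -> : b w = 0 by rewrite addr0.
  by apply: contraTeq zw => bw; rewrite le_gtF // ba.
have [az|az] := eqVneq (a z) 0; have [bz|bz] := eqVneq (b z) 0.
- by rewrite az bz addr0; apply/min_idPl; rewrite le_max lexx.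
- rewrite (_ : Num.max _ _ = 0) ?az ?add0r; first exact/min_idPr.
  apply/max_idPl; rewrite subr_le0 [leLHS](bigID (fun w => (z < w)%O)) /=.
  rewrite [X in _ + X]big1 ?addr0 => [|w nzw].
    by apply: ler_sum => w _; rewrite lerDl.
  apply: contraNeq nzw => aw; rewrite lt_neqAle ba // andbT.
  by apply: contraNneq aw => <-; rewrite az.
- rewrite bz addr0; apply/min_idPl; rewrite le_max; apply/orP; right.
  rewrite lerBrDr [leRHS](bigID (fun w => (z < w)%O)) /= [leLHS]addrC.
  rewrite [X in X + _ <= _](eq_bigr a) => [|w zw].
    by rewrite lerD2l (bigD1 z) ?ltxx //= lerDl; exact: sumr_ge0.
  exact: above_a.
- rewrite (eq_bigr a (fun w => above_a w az)).
  rewrite (_ : _ - _ = a z).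
    by rewrite (max_idPr (a0 z)); apply/min_idPr; rewrite lerDl.
  rewrite (bigID (fun w => (z < w)%O)) /= addrAC subrr add0r.
  rewrite (bigD1 z) ?ltxx //= big1 ?addr0 // => w /andP[nzw wz].
  by apply: contraNeq nzw => aw; rewrite lt_neqAle eq_sym wz ba.
Qed.

End OnePoset.

Lemma continuous_upper_share d (P : finPOrderType d) (T : topologicalType)
    (t : T -> P -> R) (l : T -> R) z :
  (forall w, continuous (fun x => t x w)) -> continuous l ->
  continuous (fun x => upper_share (t x) (l x) z).
Proof.
move=> ct cl; apply: continuous_minr; first exact: ct.
apply: continuous_maxr; first exact: continuous_const.
by apply: continuous_subr => //; apply: continuous_sumr => w; exact: ct.
Qed.

Definition order_map d (P : finPOrderType d) d' (P' : finPOrderType d')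
    (A : {set P}) (A' : {set P'}) (f : P -> P') :=
  (forall x, x \in A -> f x \in A') /\
  (forall x y, x \in A -> y \in A -> (x <= y)%O -> (f x <= f y)%O).

Definition pushforward (P P' : finType) (f : P -> P') (t : P -> R) : P' -> R :=
  fun v => \sum_(z | f z == v) t z.

Lemma pushforward_neq0 (P P' : finType) (f : P -> P') (t : P -> R) v :
  pushforward f t v != 0 -> exists2 z, f z = v & t z != 0.
Proof.
move=> tv; suff /existsP[z /andP[/eqP fz tz]] : [exists z, (f z == v) && (t z != 0)].
  by exists z.
apply: contraNT tv; rewrite negb_exists => /forallP h.
rewrite /pushforward big1 // => z fz; apply/eqP.
by have := h z; rewrite fz /= negbK.
Qed.

Lemma sum_pushforward (P P' : finType) (f : P -> P') (t : P -> R) :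
  \sum_v pushforward f t v = \sum_z t z.
Proof. by rewrite [RHS](partition_big f xpredT). Qed.

Lemma pushforward_comp (P P' P'' : finType) (f : P -> P') (g : P' -> P'')
    (t : P -> R) :
  pushforward g (pushforward f t) = pushforward (g \o f) t.
Proof.
apply/funext => v; rewrite /pushforward [RHS](partition_big f (fun w => g w == v)) //=.
apply: eq_bigr => w /eqP gw; apply: eq_bigl => z.
by case: eqP => [->|]; rewrite ?andbF // gw eqxx.
Qed.

Lemma pushforward_id (P : finType) (t : P -> R) : pushforward id t = t.
Proof. by apply/funext => v; rewrite /pushforward big_pred1_eq. Qed.

Section Sliding.
Variables (d : Order.disp_t) (P : finPOrderType d).
Variables (d' : Order.disp_t) (P' : finPOrderType d').
Variables (A : {set P}) (A' : {set P'}).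

(** The point of the target obtained when the topmost [l] units of mass travel
    by [g] and the rest by [f]. *)
Definition slide (f g : P -> P') (t : P -> R) (l : R) : P' -> R :=
  fun v => pushforward f (fun z => t z - upper_share t l z) v +
           pushforward g (upper_share t l) v.

(** For [f <= g] and [z <= w] also [f z <= g w]; since the mass that travels
    by [f] lies below the mass that travels by [g], the result is carried by a
    chain. The straight-line homotopy between the two pushforwards would not
    have this property. *)
Lemma slide_realization f g t l :
  order_map A A' f -> order_map A A' g ->
  (forall x, x \in A -> (f x <= g x)%O) -> order_realization A t ->
  order_realization A' (slide f g t l).
Proof.
move=> [fA fm] [gA gm] fg /order_realizationP[t0 t1 tA tch].
apply/order_realizationP.
have u0 := upper_share_ge0 l t0; have ul := upper_share_le t l.
have low z : t z - upper_share t l z != 0 -> t z != 0.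
  by apply: contraNneq => tz; rewrite upper_share_eq0 // tz subrr.
have upp z : upper_share t l z != 0 -> t z != 0.
  by apply: contraNneq => tz; rewrite upper_share_eq0.
have sl v : slide f g t l v != 0 ->
  (exists2 z, f z = v & t z - upper_share t l z != 0) \/
  (exists2 z, g z = v & upper_share t l z != 0).
  pose low_part z := t z - upper_share t l z.
  rewrite /slide; have [->|fv _] := eqVneq (pushforward f low_part v) 0.
    by rewrite add0r => /pushforward_neq0; right.
  by left; apply: pushforward_neq0.
have mono h : order_map A A' h -> forall z w, t z != 0 -> t w != 0 ->
    (h z >=< h w)%O.
  move=> [hA hm] z w tz tw; have /orP[zw|wz] := tch z w tz tw.
    by apply/orP; left; apply: hm => //; exact: tA.
  by apply/orP; right; apply: hm => //; exact: tA.
have mixed z w : t z - upper_share t l z != 0 -> upper_share t l w != 0 ->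
    (f z <= g w)%O.
  move=> tz tw; have zw := upper_share_split t0 tch tz tw.
  have zA := tA _ (low _ tz); have wA := tA _ (upp _ tw).
  exact: le_trans (fm _ _ zA wA zw) (fg _ wA).
split.
- move=> v; apply: addr_ge0; apply: sumr_ge0 => z _ //.
  by rewrite subr_ge0.
- rewrite big_split /= !sum_pushforward -big_split /= -t1.
  by apply: eq_bigr => z _; rewrite subrK.
- by move=> v /sl[[z <- /low tz]|[z <- /upp tz]]; [apply: fA|apply: gA]; apply: tA.
- move=> v w /sl[[z <- tz]|[z <- tz]] /sl[[z' <- tz']|[z' <- tz']].
  + by apply: (mono f) => //; exact: low.
  + by apply/orP; left; exact: mixed.
  + by apply/orP; right; exact: mixed.
  + by apply: (mono g) => //; exact: upp.
Qed.

Lemma slide_low f g t l : (forall z, 0 <= t z) -> l <= 0 ->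
  slide f g t l = pushforward f t.
Proof.
move=> t0 l0; apply/funext => v; rewrite /slide /pushforward.
under eq_bigr do rewrite upper_share_low // subr0.
by rewrite [X in _ + X]big1 ?addr0 // => z _; rewrite upper_share_low.
Qed.

Lemma slide_high f g t l : (forall z, 0 <= t z) -> \sum_z t z <= l ->
  slide f g t l = pushforward g t.
Proof.
move=> t0 l1; apply/funext => v; rewrite /slide /pushforward.
rewrite [X in X + _]big1 ?add0r => [|z _].
  by apply: eq_bigr => z _; rewrite upper_share_high.
by rewrite upper_share_high // subrr.
Qed.

Lemma pushforward_realization f t : order_map A A' f ->
  order_realization A t -> order_realization A' (pushforward f t).
Proof.
move=> fm tA; have [t0 _ _ _] := (order_realizationP A t).1 tA.
by rewrite -(slide_low f f t0 (lexx 0)); apply: slide_realization.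
Qed.

Definition realization_map f (fm : order_map A A' f) (t : order_realization A) :
    order_realization A' :=
  exist (fun u => u \in order_realization A') (pushforward f (val t))
    (mem_set (pushforward_realization fm (order_realization_prop t))).

Lemma continuous_realization_map f (fm : order_map A A' f) :
  continuous (realization_map fm).
Proof.
apply: continuous_into_subtype; apply: continuous_into_ptws => v /=.
by apply: (@continuous_sumr R (order_realization A)) => z; exact: continuous_weight.
Qed.

(** Slide the mass from the top of the chain downwards. *)
Lemma homotopic_realization_map f g (fm : order_map A A' f)
    (gm : order_map A A' g) : (forall x, x \in A -> (f x <= g x)%O) ->
  homotopic R (realization_map fm) (realization_map gm).
Proof.
move=> fg; apply/homotopicP.
pose H (u : order_realization A * unit_segment R) : order_realization A' :=
  exist (fun u => u \in order_realization A') (slide f g (val u.1) (val u.2))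
    (mem_set (slide_realization _ fm gm fg (order_realization_prop u.1))).
have ge0 (t : order_realization A) z : 0 <= val t z.
  by have [] := (order_realizationP _ _).1 (order_realization_prop t).
exists H; split=> [|t|t].
- apply: continuous_into_subtype; apply: continuous_into_ptws => v /=.
  have ct w : continuous (fun u : order_realization A * unit_segment R => val u.1 w).
    exact: continuous_compose (@continuous_fst _ _) (@continuous_weight _ _ A w).
  have cu w : continuous (fun u : order_realization A * unit_segment R =>
      upper_share (val u.1) (val u.2) w).
    apply: continuous_upper_share => //.
    exact: continuous_compose (@continuous_snd _ _) (@continuous_val _ _).
  apply: continuous_addr; apply: continuous_sumr => z; last exact: cu.
  exact: continuous_subr (ct z) (cu z).
- apply: val_inj; apply: slide_low; first exact: ge0.
  by rewrite [val _]clamp0.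
- apply: val_inj; apply: slide_high; first exact: ge0.
  have [_ -> _ _] := (order_realizationP _ _).1 (order_realization_prop t).
  by rewrite clamp1.
Qed.

End Sliding.

Definition comparable_maps d (P : finPOrderType d) d' (P' : finPOrderType d')
    (A : {set P}) (f g : P -> P') :=
  (forall x, x \in A -> (f x <= g x)%O) \/ (forall x, x \in A -> (g x <= f x)%O).

Lemma homotopic_comparable_maps d (P : finPOrderType d) d' (P' : finPOrderType d')
    (A : {set P}) (A' : {set P'}) f g
    (fm : order_map A A' f) (gm : order_map A A' g) :
  comparable_maps A f g -> homotopic R (realization_map fm) (realization_map gm).
Proof.
move=> [fg|gf]; first exact: homotopic_realization_map.
by apply: homotopic_sym; apply: homotopic_realization_map.
Qed.

Lemma order_map_comp d (P : finPOrderType d) d' (P' : finPOrderType d')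
    d'' (P'' : finPOrderType d'') (A : {set P}) (A' : {set P'}) (A'' : {set P''})
    f g :
  order_map A A' f -> order_map A' A'' g -> order_map A A'' (g \o f).
Proof.
move=> [fA fm] [gA gm]; split=> [x xA|x y xA yA xy] /=; first exact/gA/fA.
by apply: gm; [exact: fA..|exact: fm].
Qed.

Lemma order_map_id d (P : finPOrderType d) (A : {set P}) : order_map A A id.
Proof. by []. Qed.

Lemma realization_map_id d (P : finPOrderType d) (A : {set P})
    (m : order_map A A id) : realization_map m = idfun.
Proof. by apply/funext => t; apply: val_inj; exact: pushforward_id. Qed.

(** A pair of order-preserving maps that are inverse up to comparability;
    isomorphisms and closure operators are special cases. *)
Lemma order_homotopy_equivalent d (P : finPOrderType d) d' (P' : finPOrderType d')
    (A : {set P}) (A' : {set P'}) f g :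
  order_map A A' f -> order_map A' A g ->
  comparable_maps A (g \o f) id -> comparable_maps A' (f \o g) id ->
  homotopy_equivalent R (order_realization A) (order_realization A').
Proof.
move=> fm gm gf fg; exists (realization_map fm), (realization_map gm); split.
- exact: continuous_realization_map.
- exact: continuous_realization_map.
- rewrite -(realization_map_id (order_map_id A)).
  rewrite (_ : _ \o _ = realization_map (order_map_comp fm gm)).
    exact: homotopic_comparable_maps.
  by apply/funext => t; apply: val_inj; exact: pushforward_comp.
- rewrite -(realization_map_id (order_map_id A')).
  rewrite (_ : _ \o _ = realization_map (order_map_comp gm fm)).
    exact: homotopic_comparable_maps.
  by apply/funext => t; apply: val_inj; exact: pushforward_comp.
Qed.

(** The identity is comparable to [f], and [f] to a constant map. *)
Lemma contractible_conically d (P : finPOrderType d) (A : {set P}) f c :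
  order_map A A f -> c \in A -> comparable_maps A f id ->
  comparable_maps A f (fun=> c) -> contractible R (order_realization A).
Proof.
move=> fm cA fid fc.
have cm : order_map A A (fun=> c) by split=> [x _|x y _ _ _] //; exact: lexx.
have cP := order_realization_vertex cA.
exists (exist (fun u => u \in order_realization A) _ (mem_set cP)).
rewrite (_ : (fun=> _) = realization_map cm).
  apply: homotopic_trans (homotopic_comparable_maps fm cm fc).
  rewrite -(realization_map_id (order_map_id A)).
  by apply: homotopic_sym; exact: homotopic_comparable_maps.
apply/funext => t; apply: val_inj => /=.
have [_ t1 _ _] := (order_realizationP _ _).1 (order_realization_prop t).
apply/funext => z; rewrite /pushforward; case: (z =P c) => [->|zc].
  by rewrite -t1; apply: eq_bigl => w; rewrite eqxx.
by rewrite big_pred0 // => w; apply/eqP => /esym.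
Qed.

End Realization.

Arguments order_realization R {d P} A.

(** * The interval between opposite corners of a prism over an interval *)

Section Prism.
Variables (R : realType) (d : Order.disp_t) (P : finPOrderType d) (x y : P).
Hypothesis xy : (x < y)%O.
Local Notation I := (unit_segment R).
Local Notation base := (open_interval x y).
Local Notation corner_x := ((x, true) : P *p bool).
Local Notation corner_y := ((y, false) : P *p bool).

(** The product of [x, y] and a two-element chain, without its bottom and top.
    *)
Definition prism_interval : {set P *p bool} :=
  open_interval ((x, false) : P *p bool) (y, true).

Lemma prism_le (z w : P) (a b : bool) :
  (((z, a) : P *p bool) <= ((w, b) : P *p bool))%O = (z <= w)%O && (a ==> b).
Proof. by rewrite leEprod /=; congr (_ && _); case: a; case: b. Qed.

Lemma mem_prism z b : ((z, b) : P *p bool) \in prism_interval =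
  if b then (x <= z < y)%O else (x < z <= y)%O.
Proof.
rewrite inE !lt_neqAle !prism_le !xpair_eqE.
by case: b; rewrite /= ?andbT ?andbF ?(eq_sym x).
Qed.

(** These functions of the level [c] in [-1, 2] describe one meridian: for [c
    <= 0] it runs from the pole [corner_y] to level 0 of the prism, for [0 <=
    c <= 1] it crosses the prism, and for [1 <= c] it runs from level 1 to the
    pole [corner_x]. They give the mass at either pole, the amount of mass
    raised to level 1 and the mass left for the prism. *)
Definition overshoot (c : R) : R := Num.max 0 (c - 1).
Definition undershoot (c : R) : R := Num.max 0 (- c).
Definition mid_level (c : R) : R := Num.max 0 (Num.min 1 c).
Definition base_mass (c : R) : R := 1 - overshoot c - undershoot c.

Lemma prism_regime_low c :
  c <= 0 -> [/\ overshoot c = 0, undershoot c = - c & mid_level c = 0].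
Proof.
move=> c0; split.
- by apply/max_idPl; lra.
- by apply/max_idPr; lra.
- by apply/max_idPl; rewrite ge_min c0 orbT.
Qed.

Lemma prism_regime_mid c :
  0 <= c <= 1 -> [/\ overshoot c = 0, undershoot c = 0 & mid_level c = c].
Proof.
case/andP=> c0 c1; split.
- by apply/max_idPl; lra.
- by apply/max_idPl; lra.
- by rewrite /mid_level (min_idPr c1); exact/max_idPr.
Qed.

Lemma prism_regime_high c :
  1 <= c -> [/\ overshoot c = c - 1, undershoot c = 0 & mid_level c = 1].
Proof.
move=> c1; split.
- by apply/max_idPr; lra.
- by apply/max_idPl; lra.
- by rewrite /mid_level (min_idPl c1); exact/max_idPr.
Qed.

Lemma prism_regimes c :
  [\/ [/\ overshoot c = 0, undershoot c = - c, mid_level c = 0 & c <= 0],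
      [/\ overshoot c = 0, undershoot c = 0, mid_level c = c & 0 <= c <= 1] |
      [/\ overshoot c = c - 1, undershoot c = 0, mid_level c = 1 & 1 <= c]].
Proof.
have [c0|c0] := leP c 0; first by apply: Or31; case: (prism_regime_low c0) => *; split.
have [c1|c1] := leP c 1; last first.
  by apply: Or33; case: (prism_regime_high (ltW c1)) => *; split=> //; exact: ltW.
have c01 : 0 <= c <= 1 by rewrite ltW.
by have [eo eu em] := prism_regime_mid c01; apply: Or32; split; rewrite // ltW.
Qed.

(** The point at level [c] of the meridian through the point [t] of the base.
    *)
Definition prism_weight (t : P -> R) (c : R) (u : P *p bool) : R :=
  (u == corner_x)%:R * overshoot c + (u == corner_y)%:R * undershoot c +
  base_mass c * (if u.2 then upper_share t (mid_level c) u.1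
           else t u.1 - upper_share t (mid_level c) u.1).

Section Weights.
Variables (t : P -> R).
Hypothesis tP : order_realization R base t.

Lemma base_ge0 z : 0 <= t z.
Proof. by have [] := (order_realizationP _ _).1 tP. Qed.

Lemma base_sum : \sum_z t z = 1.
Proof. by have [] := (order_realizationP _ _).1 tP. Qed.

Lemma base_support z : t z != 0 -> (x < z < y)%O.
Proof. by have [_ _ h _] := (order_realizationP _ _).1 tP => /h; rewrite inE. Qed.

Lemma base_x : t x = 0.
Proof. by apply: contraTeq isT => /base_support; rewrite ltxx. Qed.

Lemma base_y : t y = 0.
Proof. by apply: contraTeq isT => /base_support; rewrite ltxx andbF. Qed.

Lemma base_chain z w : t z != 0 -> t w != 0 -> (z >=< w)%O.
Proof. by have [_ _ _ h] := (order_realizationP _ _).1 tP; exact: h. Qed.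

Lemma base_share_sum (c : R) : \sum_z upper_share t (mid_level c) z = mid_level c.
Proof.
apply: upper_share_sum; [exact: base_ge0|exact: base_chain|].
rewrite base_sum; case: (prism_regimes c) => -[_ _ -> //].
  by rewrite lexx ler01.
by rewrite lexx ler01.
Qed.

Lemma prism_weight_top c z : prism_weight t c (z, true) =
  (z == x)%:R * overshoot c + base_mass c * upper_share t (mid_level c) z.
Proof. by rewrite /prism_weight !xpair_eqE /= andbT andbF mul0r addr0. Qed.

Lemma prism_weight_bot c z : prism_weight t c (z, false) =
  (z == y)%:R * undershoot c + base_mass c * (t z - upper_share t (mid_level c) z).
Proof. by rewrite /prism_weight !xpair_eqE /= andbT andbF mul0r add0r. Qed.

Lemma sum_prism (F : P *p bool -> R) :
  \sum_u F u = \sum_z (F (z, true) + F (z, false)).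
Proof.
transitivity (\sum_z \sum_b F (z, b)).
  by rewrite pair_bigA /=; apply: eq_bigr => -[].
by apply: eq_bigr => z _; rewrite big_bool.
Qed.

(** The pole [corner_x] lies below level 1 and the pole [corner_y] above level
    0, and each carries mass only when the opposite level is empty; inside the
    prism the mass at level 0 lies below the mass at level 1. *)
Lemma prism_weight_realization c : -1 <= c <= 2 ->
  order_realization R prism_interval (prism_weight t c).
Proof.
move=> /andP[c1 c2]; have u0 := upper_share_ge0 (mid_level c) base_ge0.
have ul := upper_share_le t (mid_level c).
have over0 : 0 <= overshoot c by rewrite le_max lexx.
have under0 : 0 <= undershoot c by rewrite le_max lexx.
have mass0 : 0 <= base_mass c.
  by rewrite /base_mass; case: (prism_regimes c) => -[-> -> _ ?]; lra.
have top z : prism_weight t c (z, true) != 0 ->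
    z = x /\ overshoot c != 0 \/ (x < z < y)%O /\ upper_share t (mid_level c) z != 0.
  rewrite prism_weight_top; case: (z =P x) => [->|_].
    rewrite (upper_share_eq0 _ base_ge0 base_x) mulr0 addr0 mul1r.
    by left.
  rewrite mul0r add0r mulf_eq0 negb_or => /andP[_ uz]; right; split=> //.
  by apply: base_support; apply: contraNneq uz => /(upper_share_eq0 _ base_ge0) ->.
have bot z : prism_weight t c (z, false) != 0 ->
    z = y /\ undershoot c != 0 \/ (x < z < y)%O /\ t z - upper_share t (mid_level c) z != 0.
  rewrite prism_weight_bot; case: (z =P y) => [->|_].
    rewrite (upper_share_eq0 _ base_ge0 base_y) base_y subr0 mulr0 addr0 mul1r.
    by left.
  rewrite mul0r add0r mulf_eq0 negb_or => /andP[_ uz]; right; split=> //.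
  apply: base_support; apply: contraNneq uz => tz.
  by rewrite (upper_share_eq0 _ base_ge0) // tz subrr.
have over_bot z : overshoot c != 0 -> prism_weight t c (z, false) = 0.
  rewrite prism_weight_bot.
  case: (prism_regimes c) => -[-> -> -> c_]; rewrite ?eqxx //= => _.
  rewrite mulr0 add0r upper_share_high ?subrr ?mulr0 //; first exact: base_ge0.
  by rewrite base_sum.
have under_top z : undershoot c != 0 -> prism_weight t c (z, true) = 0.
  rewrite prism_weight_top.
  case: (prism_regimes c) => -[-> -> -> c_]; rewrite ?eqxx //= => _.
  by rewrite mulr0 add0r upper_share_low ?mulr0 //; exact: base_ge0.
have low z : t z - upper_share t (mid_level c) z != 0 -> t z != 0.
  by apply: contraNneq => tz; rewrite (upper_share_eq0 _ base_ge0) // tz subrr.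
have upp z : upper_share t (mid_level c) z != 0 -> t z != 0.
  by apply: contraNneq => tz; rewrite (upper_share_eq0 _ base_ge0).
have toptop z w : prism_weight t c (z, true) != 0 ->
    prism_weight t c (w, true) != 0 -> (z >=< w)%O.
  move=> /top[[-> _]|[/andP[xz _] uz]] /top[[-> _]|[/andP[xw _] uw]].
  - exact: comparablexx.
  - by rewrite /Order.comparable (ltW xw).
  - by rewrite /Order.comparable (ltW xz) orbT.
  - by apply: base_chain; exact: upp.
have botbot z w : prism_weight t c (z, false) != 0 ->
    prism_weight t c (w, false) != 0 -> (z >=< w)%O.
  move=> /bot[[-> _]|[/andP[_ xz] uz]] /bot[[-> _]|[/andP[_ xw] uw]].
  - exact: comparablexx.
  - by rewrite /Order.comparable (ltW xw) orbT.
  - by rewrite /Order.comparable (ltW xz).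
  - by apply: base_chain; exact: low.
have bottop z w : prism_weight t c (z, false) != 0 ->
    prism_weight t c (w, true) != 0 -> (z <= w)%O.
  move=> tz tw; case: (top _ tw) => [[_ /(over_bot z) tz0]|[_ uw]].
    by rewrite tz0 eqxx in tz.
  case: (bot _ tz) => [[_ /(under_top w) tw0]|[_ uz]].
    by rewrite tw0 eqxx in tw.
  exact: (@upper_share_split R _ P t (mid_level c) base_ge0 base_chain z w uz uw).
apply/order_realizationP; split.
- case=> z [|]; rewrite ?prism_weight_top ?prism_weight_bot.
    exact: addr_ge0 (mulr_ge0 (ler0n _ _) over0) (mulr_ge0 mass0 (u0 z)).
  apply: addr_ge0 (mulr_ge0 (ler0n _ _) under0) (mulr_ge0 mass0 _).
  by rewrite subr_ge0.
- rewrite sum_prism.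
  under eq_bigr do rewrite prism_weight_top prism_weight_bot addrACA -mulrDr.
  under eq_bigr do rewrite [upper_share _ _ _ + _]addrC subrK.
  rewrite big_split /= -mulr_sumr base_sum mulr1 big_split /= -!mulr_suml.
  have delta (v : P) : \sum_z (z == v)%:R = 1 :> R.
    by rewrite (bigD1 v) //= eqxx big1 ?addr0 // => z /negbTE ->.
  by rewrite !delta !mul1r /base_mass; lra.
- case=> z [|] tz; rewrite mem_prism.
    by case: (top _ tz) => [[-> _]|[/andP[/ltW -> ->]]] //; rewrite lexx xy.
  by case: (bot _ tz) => [[-> _]|[/andP[-> /ltW ->]]] //; rewrite lexx xy.
- move=> [z [|]] [w [|]] tz tw; rewrite /Order.comparable !prism_le /= ?andbT ?andbF ?orbF //=.
  + exact: toptop.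
  + exact: bottop.
  + exact: bottop.
  + exact: botbot.
Qed.

(** The level can be read off from the masses at the poles and at level 1. *)
Lemma prism_weight_latitude c : -1 <= c <= 2 ->
  2 * prism_weight t c corner_x +
    \sum_(z | z != x) prism_weight t c (z, true) - prism_weight t c corner_y = c.
Proof.
move=> /andP[c1 c2]; rewrite prism_weight_top prism_weight_bot !eqxx !mul1r.
rewrite !(upper_share_eq0 _ base_ge0) ?base_x ?base_y // subr0 !mulr0 !addr0.
under eq_bigr => z zx do rewrite prism_weight_top (negbTE zx) mul0r add0r.
have -> : \sum_(z | z != x) base_mass c * upper_share t (mid_level c) z = base_mass c * mid_level c.
  rewrite -mulr_sumr -(base_share_sum c) [in RHS](bigD1 x) //=.
  by rewrite (upper_share_eq0 _ base_ge0 base_x) add0r base_share_sum.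
by rewrite /base_mass; case: (prism_regimes c) => -[-> -> -> ?]; lra.
Qed.

Lemma prism_weight_total c z : x != z -> z != y ->
  prism_weight t c (z, true) + prism_weight t c (z, false) = base_mass c * t z.
Proof.
move=> xz zy; rewrite prism_weight_top prism_weight_bot (negbTE zy).
by rewrite eq_sym (negbTE xz) !mul0r !add0r -mulrDr [upper_share _ _ _ + _]addrC subrK.
Qed.

End Weights.

Lemma base_mass_gt0 c : -1 < c < 2 -> 0 < base_mass c.
Proof.
by case/andP=> c1 c2; rewrite /base_mass; case: (prism_regimes c) => -[-> -> _ ?]; lra.
Qed.

Lemma base_mass_eq0 c : c = -1 \/ c = 2 -> base_mass c = 0.
Proof.
by move=> ce; rewrite /base_mass; case: (prism_regimes c) => -[-> -> _ ?]; lra.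
Qed.

Lemma prism_weight_inj t t' c : order_realization R base t ->
  order_realization R base t' -> -1 < c < 2 ->
  prism_weight t c = prism_weight t' c -> t = t'.
Proof.
move=> tP t'P c12 e; apply/funext => z.
have [zx|zx] := eqVneq x z; first by rewrite -zx !base_x.
have [->|zy] := eqVneq z y; first by rewrite !base_y.
have r0 : base_mass c != 0 by rewrite gt_eqF // base_mass_gt0.
by apply: (mulfI r0); rewrite -!prism_weight_total // e.
Qed.

Section Cover.
Variable q : P *p bool -> R.
Hypothesis qP : order_realization R prism_interval q.

Let a z := if z == x then 0 else q (z, true).
Let b z := if z == y then 0 else q (z, false).

(** Forgetting the levels and the poles and normalizing gives the point [t] of
    the base. Since the support of [q] is a chain, its mass at level 1 is the
    topmost part of its mass, so that [q] is determined by [t] and the level.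
    *)
Lemma prism_cover : q corner_x != 1 -> q corner_y != 1 ->
  exists t c, [/\ order_realization R base t, -1 < c < 2 & q = prism_weight t c].
Proof.
move=> qx1 qy1; have [q0 q1 qQ qch] := (order_realizationP _ _).1 qP.
have qtop z : q (z, true) != 0 -> (x <= z < y)%O by move=> /qQ; rewrite mem_prism.
have qbot z : q (z, false) != 0 -> (x < z <= y)%O by move=> /qQ; rewrite mem_prism.
have qbt z w : q (z, false) != 0 -> q (w, true) != 0 -> (z <= w)%O.
  move=> qz qw; have := qch _ _ qz qw.
  by rewrite /Order.comparable !prism_le /= andbT andbF orbF.
have qtt z w : q (z, true) != 0 -> q (w, true) != 0 -> (z >=< w)%O.
  move=> qz qw; have := qch _ _ qz qw.
  by rewrite /Order.comparable !prism_le /= !andbT.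
have qbb z w : q (z, false) != 0 -> q (w, false) != 0 -> (z >=< w)%O.
  move=> qz qw; have := qch _ _ qz qw.
  by rewrite /Order.comparable !prism_le /= !andbT.
have a0 z : 0 <= a z by rewrite /a; case: ifP.
have b0 z : 0 <= b z by rewrite /b; case: ifP.
have aq z : a z != 0 -> z != x /\ q (z, true) != 0.
  by rewrite /a; case: (z =P x) => //; rewrite eqxx.
have bq z : b z != 0 -> z != y /\ q (z, false) != 0.
  by rewrite /b; case: (z =P y) => //; rewrite eqxx.
have qx_b z : q corner_x != 0 -> q (z, false) = 0.
  move=> qx; apply: contraTeq isT => qz; have := qbt _ _ qz qx.
  by have /andP[/lt_geF ->] := qbot _ qz.
have qy_a z : q corner_y != 0 -> q (z, true) = 0.
  move=> qy; apply: contraTeq isT => qz; have := qbt _ _ qy qz.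
  by have /andP[_ /lt_geF ->] := qtop _ qz.
have qtopE z : q (z, true) = (z == x)%:R * q corner_x + a z.
  by rewrite /a; case: (z =P x) => [->|]; rewrite ?mul1r ?addr0 ?mul0r ?add0r.
have qbotE z : q (z, false) = (z == y)%:R * q corner_y + b z.
  by rewrite /b; case: (z =P y) => [->|]; rewrite ?mul1r ?addr0 ?mul0r ?add0r.
have total : q corner_x + q corner_y + \sum_z a z + \sum_z b z = 1.
  rewrite -q1 sum_prism big_split /=.
  rewrite (eq_bigr _ (fun z _ => qtopE z)) big_split /=.
  rewrite [X in _ = _ + X](eq_bigr _ (fun z _ => qbotE z)) big_split /=.
  rewrite -!mulr_suml.
  have delta (v : P) : \sum_z (z == v)%:R = 1 :> R.
    by rewrite (bigD1 v) //= eqxx big1 ?addr0 // => z /negbTE ->.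
  by rewrite !delta !mul1r; lra.
have sa0 : 0 <= \sum_z a z by exact: sumr_ge0.
have sb0 : 0 <= \sum_z b z by exact: sumr_ge0.
have := q0 corner_x; have := q0 corner_y => qy0 qx0.
have qxy : q corner_x = 0 \/ q corner_y = 0.
  by have [|/qy_a] := eqVneq (q corner_y) 0; [right|left].
pose r := 1 - q corner_x - q corner_y.
have r_gt0 : 0 < r.
  have : r != 0.
    rewrite /r; case: qxy => ->; rewrite ?subr0 subr_eq0 eq_sym //.
  by rewrite lt_neqAle eq_sym => -> /=; rewrite /r; lra.
have rE : r = \sum_z a z + \sum_z b z by rewrite /r; lra.
(* [a] and [b] are the masses of [q] at levels 1 and 0 without the poles,
   and [r] is their total. *)
pose t z := (a z + b z) / r.
have tP : order_realization R base t.
  have tn0 z : t z != 0 -> (a z != 0) || (b z != 0).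
    apply: contraNT; rewrite negb_or !negbK => /andP[/eqP az /eqP bz].
    by rewrite /t az bz addr0 mul0r.
  apply/order_realizationP; split.
  - by move=> z; apply: divr_ge0; [exact: addr_ge0|exact: ltW].
  - by rewrite -mulr_suml big_split /= -rE divff // gt_eqF.
  - move=> z /tn0 /orP[/aq[zx /qtop]|/bq[zy /qbot]]; rewrite inE.
      by rewrite le_eqVlt eq_sym (negbTE zx).
    by rewrite le_eqVlt (negbTE zy).
  - move=> z w /tn0 /orP[/aq[_ qz]|/bq[_ qz]] /tn0 /orP[/aq[_ qw]|/bq[_ qw]].
    + exact: qtt.
    + by rewrite /Order.comparable (qbt _ _ qw qz) orbT.
    + by rewrite /Order.comparable (qbt _ _ qz qw).
    + exact: qbb.
pose c := 2 * q corner_x + \sum_z a z - q corner_y.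
exists t, c; have [t0 t1 _ _] := (order_realizationP _ _).1 tP.
have rt z : r * t z = a z + b z by rewrite /t mulrC divfK // gt_eqF.
split=> //.
  have qx_lt : q corner_x < 1 by rewrite lt_neqAle qx1; lra.
  have qy_lt : q corner_y < 1 by rewrite lt_neqAle qy1; lra.
  by rewrite /c; apply/andP; split; lra.
suff [eo eu er es] : [/\ overshoot c = q corner_x, undershoot c = q corner_y,
    base_mass c = r & forall z, r * upper_share t (mid_level c) z = a z].
  apply/funext => -[z [|]].
    by rewrite prism_weight_top eo er es -qtopE.
  by rewrite prism_weight_bot eu er mulrBr rt es addrAC subrr add0r -qbotE.
have [qx|qx] := eqVneq (q corner_x) 0; last first.
  have b00 z : b z = 0 by rewrite /b qx_b // if_same.
  have sb : \sum_z b z = 0 by rewrite big1.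
  have qy : q corner_y = 0 by case: qxy => // /eqP; rewrite (negbTE qx).
  have cE : c = 1 + q corner_x by clear -total sb qy; rewrite /c; lra.
  have [|eo eu em] := @prism_regime_high c; first by rewrite cE lerDl.
  have {}eo : overshoot c = q corner_x by rewrite eo cE addrC addKr.
  rewrite eo eu em /base_mass eo eu qy /r qy; split=> // z.
  have := rt z; rewrite b00 addr0 /r qy => <-.
  by rewrite upper_share_high ?t1.
have [qy|qy] := eqVneq (q corner_y) 0; last first.
  have a00 z : a z = 0 by rewrite /a qy_a // if_same.
  have sa : \sum_z a z = 0 by rewrite big1.
  have cE : c = - q corner_y by rewrite /c sa qx mulr0 !add0r.
  have [|eo eu em] := @prism_regime_low c; first by rewrite cE oppr_le0.
  have {}eu : undershoot c = q corner_y by rewrite eu cE opprK.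
  rewrite eo eu em /base_mass eo eu qx /r qx; split=> // z.
  by rewrite upper_share_low // mulr0 a00.
have cE : c = \sum_z a z by rewrite /c qx qy mulr0 add0r subr0.
have [|eo eu em] := @prism_regime_mid c; first by rewrite cE sa0; lra.
rewrite eo eu em /base_mass eo eu /r qx qy; split=> // z.
have -> : t = (fun z => a z + b z).
  by apply/funext => w; rewrite -rt /r qx qy !subr0 mul1r.
rewrite !subr0 mul1r cE; apply: upper_share_recover => // v w /bq[_ qv] /aq[_ qw].
exact: qbt.
Qed.

End Cover.

Lemma prism_level (s : I) : -1 <= 3 * val s - 1 <= 2.
Proof. by have /andP[s0 s1] := segment_bounds s; lra. Qed.

Definition prism_meridian (ts : order_realization R base * I) :
    order_realization R prism_interval :=
  exist (fun q => q \in order_realization R prism_interval)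
    (prism_weight (val ts.1) (3 * val ts.2 - 1))
    (mem_set (prism_weight_realization (order_realization_prop ts.1)
                                       (prism_level ts.2))).

Lemma continuous_prism_meridian : continuous prism_meridian.
Proof.
have ct z : continuous (fun ts : order_realization R base * I => val ts.1 z).
  exact: continuous_compose (@continuous_fst _ _) (@continuous_weight R _ _ base z).
have cc : continuous (fun ts : order_realization R base * I => 3 * val ts.2 - 1).
  apply: continuous_subr; last exact: continuous_const.
  apply: continuous_mulr; first exact: continuous_const.
  exact: continuous_compose (@continuous_snd _ _) (@continuous_val _ _).
have co : continuous (fun ts : order_realization R base * I =>
    overshoot (3 * val ts.2 - 1)).
  apply: continuous_maxr; first exact: continuous_const.
  by apply: continuous_subr => //; exact: continuous_const.
have cu : continuous (fun ts : order_realization R base * I =>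
    undershoot (3 * val ts.2 - 1)).
  by apply: continuous_maxr; [exact: continuous_const|exact: continuous_oppr].
have cm : continuous (fun ts : order_realization R base * I =>
    mid_level (3 * val ts.2 - 1)).
  apply: continuous_maxr; first exact: continuous_const.
  by apply: continuous_minr => //; exact: continuous_const.
have cr : continuous (fun ts : order_realization R base * I =>
    base_mass (3 * val ts.2 - 1)).
  apply: continuous_subr => //.
  by apply: continuous_subr => //; exact: continuous_const.
have cs z := @continuous_upper_share R _ P _ _ _ z ct cm.
apply: continuous_into_subtype; apply: continuous_into_ptws => -[z e] /=.
apply: continuous_addr.
  by apply: continuous_addr; apply: continuous_mulr => //; exact: continuous_const.
apply: continuous_mulr => //=.
case: e; [exact: cs|exact: continuous_subr (ct z) (cs z)].
Qed.

Lemma corner_x_prism : corner_x \in prism_interval.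
Proof. by rewrite mem_prism lexx. Qed.

Lemma corner_y_prism : corner_y \in prism_interval.
Proof. by rewrite mem_prism lexx xy. Qed.

Lemma prism_weight_ends t u : order_realization R base t ->
  prism_weight t 2 u = (u == corner_x)%:R /\
  prism_weight t (-1) u = (u == corner_y)%:R.
Proof.
move=> tP; rewrite /prism_weight (base_mass_eq0 (or_introl erefl)).
rewrite (base_mass_eq0 (or_intror erefl)) !mul0r !addr0.
split; [case: (prism_regimes 2)|case: (prism_regimes (-1))] => -[-> -> _ ?];
  rewrite ?mulr0; lra.
Qed.

(** The parameter in [0, 1] is rescaled to the level in [-1, 2]. *)
Definition prism_suspension :
  suspension R (order_realization R base) (order_realization R prism_interval).
Proof.
pose pole u (uP : u \in prism_interval) : order_realization R prism_interval :=
  exist (fun q => q \in order_realization R prism_interval) _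
    (mem_set (order_realization_vertex R uP)).
apply: (@Suspension R _ _ prism_meridian (pole _ corner_y_prism)
  (pole _ corner_x_prism) (fun q => (2 * val q corner_x +
    \sum_(z | z != x) val q (z, true) - val q corner_y + 1) / 3)).
- exact: continuous_prism_meridian.
- rewrite /= !xpair_eqE !eqxx /= andbF mulr0n big1 => [|z _].
    by rewrite mulr0 addr0 sub0r addNr mul0r.
  by rewrite xpair_eqE andbF.
- rewrite /= !xpair_eqE !eqxx /= andbF mulr0n big1 => [|z zx]; first by lra.
  by rewrite xpair_eqE (negbTE zx).
- move=> t s; rewrite prism_weight_latitude; first by lra.
    exact: order_realization_prop.
  exact: prism_level.
- move=> t t' s /andP[s0 s1] /(congr1 val) /= e; apply: val_inj.
  apply: (prism_weight_inj (order_realization_prop _) (order_realization_prop _) _ e).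
  by move: s0 s1 => /= s0 s1; apply/andP; split; lra.
- move=> t; apply: val_inj; rewrite [LHS]/= [Num.max _ _]clamp0 mulr0 sub0r.
  by apply/funext => u; case: (prism_weight_ends u (order_realization_prop t)).
- move=> t; apply: val_inj; rewrite [LHS]/= [Num.max _ _]clamp1.
  rewrite (_ : 3 * 1 - 1 = 2); last by lra.
  by apply/funext => u; case: (prism_weight_ends u (order_realization_prop t)).
- move=> q; have qP := order_realization_prop q.
  have [qx|qx] := eqVneq (val q corner_x) 1.
    by apply: Or32; apply: val_inj; exact: (order_realization_vertexP qP qx).
  have [qy|qy] := eqVneq (val q corner_y) 1.
    by apply: Or31; apply: val_inj; exact: (order_realization_vertexP qP qy).
  have [t [c [tP /andP[c1 c2] qE]]] := prism_cover qP qx qy.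
  have c01 : 0 <= (c + 1) / 3 <= 1 by apply/andP; split; lra.
  apply: Or33; exists (exist (fun t => t \in order_realization R base) t (mem_set tP)).
  exists (clamp ((c + 1) / 3)); split.
    by rewrite val_clamp //; apply/andP; split; lra.
  apply: val_inj; rewrite [RHS]/= [Num.max _ _](@val_clamp R) //.
  by rewrite (_ : 3 * _ - 1 = c) //; lra.
Defined.

End Prism.

(** * Doubling at an order-convex subset *)

Section Spherical.
Variable R : realType.

Definition contractible_or_spherical d (P : finPOrderType d) (A : {set P}) :=
  contractible R (order_realization R A) \/ sphere_like R (order_realization R A).

Lemma homotopy_contractible_or_spherical d (P : finPOrderType d)
    d' (P' : finPOrderType d') (A : {set P}) (A' : {set P'}) :
  homotopy_equivalent R (order_realization R A) (order_realization R A') ->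
  contractible_or_spherical A' -> contractible_or_spherical A.
Proof.
move=> AA' [cA'|sA']; [left|right].
  exact: contractible_homotopy_equivalent AA' cA'.
exact: sphere_like_homotopy_equivalent AA' sA'.
Qed.

(** The sphere of dimension -1 is empty. *)
Lemma empty_spherical d (P : finPOrderType d) (A : {set P}) :
  A = finset.set0 -> contractible_or_spherical A.
Proof.
move=> A0; right; exists 0.
have no_t (t : order_realization R A) : False.
  have [_ t1 tA _] := (order_realizationP _ _).1 (order_realization_prop t).
  have: \sum_z val t z = 0.
    rewrite big1 // => z _; apply/eqP; apply: contraT => /tA.
    by rewrite A0 inE.
  by rewrite t1 => /eqP; rewrite oner_eq0.
have no_u (u : unit_sphere R 0) : False.
  by have := sphere_sum u; rewrite big_ord0 => /eqP; rewrite eq_sym oner_eq0.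
exists (fun t => match no_t t with end), (fun u => match no_u u with end).
split=> [t|u||]; [by case: (no_t t)|by case: (no_u u)| |].
  rewrite (_ : _ \o _ = idfun); first by apply: homotopic_refl => t; case: (no_t t).
  by apply/funext => t; case: (no_t t).
rewrite (_ : _ \o _ = idfun); first by apply: homotopic_refl => u; case: (no_u u).
by apply/funext => u; case: (no_u u).
Qed.

Lemma suspension_contractible_or_spherical d (P : finPOrderType d) (x y : P) :
  (x < y)%O -> contractible_or_spherical (open_interval x y) ->
  contractible_or_spherical (prism_interval x y).
Proof.
move=> xy; have kX := @compact_order_realization R _ _ (open_interval x y).
have hZ := @hausdorff_order_realization R _ _ (prism_interval x y).
pose sX := prism_suspension R xy.
move=> [cX|[n Xn]]; [left|right].
  exact: (suspension_contractible sX kX hZ cX).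
exists n.+1; apply: (suspension_homotopy_equivalent sX (sphere_suspension R n)) => //.
  exact: compact_sphere.
exact: hausdorff_sphere.
Qed.

Lemma upset_le d (P : finPOrderType d) (C : {set P}) x y :
  x \in upset C -> (x <= y)%O -> y \in upset C.
Proof.
rewrite !inE => /existsP[c /andP[cC cx]] xy.
by apply/existsP; exists c; rewrite cC (le_trans cx).
Qed.

Lemma sub_upset d (P : finPOrderType d) (C : {set P}) x :
  x \in C -> x \in upset C.
Proof. by move=> xC; rewrite inE; apply/existsP; exists x; rewrite xC lexx. Qed.

Lemma upset_convex d (P : finPOrderType d) (C : {set P}) x y :
  order_convex C -> x \in upset C -> y \in C -> (x <= y)%O -> x \in C.
Proof.
move=> Cc; rewrite inE => /existsP[c /andP[cC cx]] yC xy.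
by apply: (Cc c y x) => //; rewrite cx.
Qed.

Lemma mem_doubling_set d (P : finPOrderType d) (C : {set P}) z b :
  ((z, b) : P *p bool) \in doubling_set C =
  if b then z \in upset C else (z \notin upset C) || (z \in C).
Proof.
rewrite /doubling_set finset.in_setU !finset.in_setX !finset.in_set1 finset.in_setU finset.in_setC.
by case: b; rewrite /= ?andbT ?andbF ?orbF.
Qed.

Section Doubling.
Variables (d : Order.disp_t) (P : finPOrderType d) (C : {set P}).
Variables (d' : Order.disp_t) (M : finPOrderType d').
Variables (p : M -> P) (lev : M -> bool).
Hypothesis C_convex : order_convex C.
Hypothesis leE : forall a b : M,
  (a <= b)%O = (p a <= p b)%O && (lev a ==> lev b).
Hypothesis mem_pl : forall a, ((p a, lev a) : P *p bool) \in doubling_set C.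
Hypothesis surj_pl : forall z b, ((z, b) : P *p bool) \in doubling_set C ->
  exists a, p a = z /\ lev a = b.

Lemma doubling_inj a b : p a = p b -> lev a = lev b -> a = b.
Proof.
by move=> pab lab; apply: le_anti; rewrite !leE pab lab !lexx !implybb.
Qed.

Lemma doubling_lt a b : (a < b)%O =
  [&& (p a != p b) || (lev a != lev b), (p a <= p b)%O & lev a ==> lev b].
Proof.
rewrite lt_neqAle leE; congr (_ && _); rewrite -negb_and; congr (~~ _).
apply/eqP/andP => [->|[/eqP pab /eqP lab]]; first by rewrite !eqxx.
exact: doubling_inj.
Qed.

Lemma doubling_section (a0 : M) : exists g : P -> bool -> M,
  forall z b, ((z, b) : P *p bool) \in doubling_set C ->
    p (g z b) = z /\ lev (g z b) = b.
Proof.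
have /choice[g gP] : forall u : P * bool, exists a : M,
    ((u.1, u.2) : P *p bool) \in doubling_set C -> p a = u.1 /\ lev a = u.2.
  move=> [z b] /=; have [|zb] := boolP (((z, b) : P *p bool) \in doubling_set C).
    by move=> /surj_pl[a aP]; exists a.
  by exists a0.
by exists (fun z b => g (z, b)) => z b; exact: (gP (z, b)).
Qed.

(** Here [M] is any poset isomorphic to the doubling: [p] and [lev] are the
    two coordinates. This form covers the doubling itself as well as a
    quotient lattice that turns out to be a doubling. *)
Lemma doubling_intervals :
  intervals_contractible_or_spherical P R ->
  intervals_contractible_or_spherical M R.
Proof.
move=> goodP a b ab I; rewrite {}/I -/(contractible_or_spherical _).
have [g gP] := doubling_section a.
have gK m : g (p m) (lev m) = m.
  by case: (gP _ _ (mem_pl m)) => gp gl; exact: doubling_inj.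
have memO m : m \in open_interval a b = (a < m < b)%O by rewrite inE.
have Da := mem_pl a; have Db := mem_pl b.
rewrite !mem_doubling_set in Da Db.
move: (ab); rewrite doubling_lt => /and3P[ab_ne pab lab].
(* Ends on the same level: an interval of [P]. *)
have [lE|lN] := eqVneq (lev a) (lev b).
  have {ab_ne}pab : (p a < p b)%O.
    by rewrite lt_neqAle pab andbT; move: ab_ne; rewrite lE eqxx orbF.
  have lm m : (a < m < b)%O -> lev m = lev a.
    rewrite !doubling_lt lE => /andP[/and3P[_ _ am] /and3P[_ _ mb]].
    by move: am mb; case: (lev m); case: (lev b).
  have Dz z : (p a < z < p b)%O -> ((z, lev a) : P *p bool) \in doubling_set C.
    move=> /andP[az zb]; rewrite mem_doubling_set.
    move: Da Db; rewrite -lE; case: (lev a) => [Da _|_ Db].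
      exact: upset_le Da (ltW az).
    have [zu|//] /= := boolP (z \in upset C).
    move: Db; rewrite (upset_le zu (ltW zb)) /= => bC.
    exact: upset_convex zu bC (ltW zb).
  apply: (@homotopy_contractible_or_spherical _ _ _ _ _ (open_interval (p a) (p b)));
    last exact: goodP.
  apply: (@order_homotopy_equivalent R _ _ _ _ _ _ p (fun z => g z (lev a))).
  - split=> [m|m m' _ _]; last by rewrite leE => /andP[].
    rewrite !inE => mI; have := lm _ mI; move: mI; rewrite !doubling_lt.
    by rewrite !lt_neqAle => /andP[/and3P[+ -> _] /and3P[+ -> _]] lE';
      rewrite lE' -lE eqxx !orbF !andbT => -> ->.
  - split=> [z|z z']; rewrite !inE => zI.
      have [pz lz] := gP _ _ (Dz z zI); rewrite !doubling_lt pz lz -lE eqxx !orbF.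
      by case/andP: zI; rewrite !lt_neqAle implybb => /andP[-> ->] /andP[-> ->].
    move=> z'I zz'; have [pz lz] := gP _ _ (Dz z zI).
    by have [pz' lz'] := gP _ _ (Dz z' z'I); rewrite leE pz lz pz' lz' zz' implybb.
  - by left=> m; rewrite inE /= => /lm <-; rewrite gK.
  - by left=> z; rewrite inE /= => /Dz/gP[->].
have {lN lab}[la lb] : lev a = false /\ lev b = true.
  by move: lN lab; case: (lev a); case: (lev b).
rewrite la /= in Da; rewrite lb /= in Db.
have bndm m : (a < m < b)%O -> (p a <= p m <= p b)%O.
  by rewrite !doubling_lt => /andP[/and3P[_ -> _] /and3P[_ -> _]].
have am z c : ((z, c) : P *p bool) \in doubling_set C -> (p a <= z)%O ->
    (p a != z) || c -> (a < g z c)%O.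
  by move=> /gP[pz lz] az anz; rewrite doubling_lt pz lz la az andbT; case: (c) anz.
have mb z c : ((z, c) : P *p bool) \in doubling_set C -> (z <= p b)%O ->
    (z != p b) || ~~ c -> (g z c < b)%O.
  move=> /gP[pz lz] zb bnz; rewrite doubling_lt pz lz lb zb implybT andbT.
  by rewrite andbT; case: (c) bnz.
have ma m : (a < m < b)%O -> p m = p a -> lev m.
  move=> /andP[+ _] e; rewrite doubling_lt la e eqxx /=.
  by case: (lev m).
have mbl m : (a < m < b)%O -> p m = p b -> ~~ lev m.
  move=> /andP[_ +] e; rewrite doubling_lt lb e eqxx /=.
  by case: (lev m).
have [pE|pN] := eqVneq (p a) (p b).
  apply: empty_spherical; apply/finset.setP => m; rewrite finset.in_set0; apply/negbTE/negP.
  rewrite memO => mI; have /andP[am' mb'] := bndm _ mI.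
  have e : p m = p a by apply: le_anti; rewrite am' pE mb'.
  have := ma _ mI e; have := mbl _ mI; rewrite -pE => /(_ e) /negbTE ->.
  by [].
have {ab_ne}pab' : (p a < p b)%O by rewrite lt_neqAle pN.
have [aC|aC] := boolP (p a \in C); have [bC|bC] := boolP (p b \in C).
(* Both ends in [C]: the interval of the prism. *)
- have Dz z c : (p a <= z <= p b)%O -> ((z, c) : P *p bool) \in doubling_set C.
    move=> zI; have zC : z \in C by exact: C_convex aC bC zI.
    by rewrite mem_doubling_set zC (sub_upset zC) orbT if_same.
  apply: (@homotopy_contractible_or_spherical _ _ _ _ _ (prism_interval (p a) (p b)));
    last by apply: suspension_contractible_or_spherical => //; exact: goodP.
  have memP z c : ((z, c) : P *p bool) \in prism_interval (p a) (p b) ->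
      [/\ (p a <= z <= p b)%O, (p a != z) || c & (z != p b) || ~~ c].
    rewrite mem_prism; case: c => /andP[az zb].
      by rewrite az (ltW zb) (lt_eqF zb) orbT.
    by rewrite zb (ltW az) (lt_eqF az) orbT.
  apply: (@order_homotopy_equivalent R _ _ _ _ _ _
    (fun m => (p m, lev m) : P *p bool) (fun u => g u.1 u.2)).
  - split=> [m|m m' _ _]; last by rewrite leE prism_le.
    rewrite memO => mI; rewrite mem_prism; have /andP[am' mb'] := bndm _ mI.
    have := ma _ mI; have := mbl _ mI; case: (lev m) => h1 h2.
      rewrite am' lt_neqAle mb' andbT; apply/negP => /eqP /h1; by [].
    by rewrite mb' lt_neqAle am' !andbT eq_sym; apply/negP => /eqP /h2.
  - split=> [[z c] /memP[zI za zb]|[z c] [z' c'] /memP[zI _ _] /memP[zI' _ _]].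
      have D := Dz _ c zI; case/andP: zI => az zb'.
      by rewrite memO /= am // mb.
    rewrite prism_le /= leE; have [-> ->] := gP _ _ (Dz _ c zI).
    by have [-> ->] := gP _ _ (Dz _ c' zI').
  - by left=> m _ /=; rewrite gK.
  - left=> -[z c] /memP[zI _ _] /=.
    by have [-> ->] := gP _ _ (Dz _ c zI).
(* Raise every element to level 1; the result lies above the copy of [p a]
   there. *)
- left; have Dz z : (p a <= z)%O -> ((z, true) : P *p bool) \in doubling_set C.
    by move=> az; rewrite mem_doubling_set; exact: upset_le (sub_upset aC) az.
  have topN m : (a < m < b)%O -> p m != p b.
    move=> mI; apply/eqP => e; have := mem_pl m; rewrite mem_doubling_set.
    by rewrite (negbTE (mbl _ mI e)) e Db (negbTE bC).
  apply: (@contractible_conically R _ _ _ (fun m => g (p m) true) (g (p a) true)).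
  - split=> [m|m m']; rewrite !memO => mI.
      have /andP[am' mb'] := bndm _ mI.
      by rewrite am ?mb ?Dz ?orbT ?topN.
    move=> mI' mm'; rewrite leE; have /andP[am1 _] := bndm _ mI.
    have /andP[am2 _] := bndm _ mI'.
    have [-> ->] := gP _ _ (Dz _ am1); have [-> ->] := gP _ _ (Dz _ am2).
    by move: mm'; rewrite leE => /andP[->].
  - by rewrite memO am ?mb ?Dz ?orbT ?pN.
  - right=> m; rewrite memO => /bndm /andP[am' _]; rewrite leE.
    by have [-> ->] := gP _ _ (Dz _ am'); rewrite lexx implybT.
  - right=> m; rewrite memO => /bndm /andP[am' _]; rewrite leE.
    have [-> ->] := gP _ _ (Dz _ am').
    by have [-> ->] := gP _ _ (Dz _ (lexx _)); rewrite am'.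
(* Lower every element to level 0; the result lies below the copy of [p b]
   there. *)
- left; have aU : p a \notin upset C by move: Da; rewrite (negbTE aC) orbF.
  have Dz z : (z <= p b)%O -> ((z, false) : P *p bool) \in doubling_set C.
    move=> zb; rewrite mem_doubling_set; have [zU|//] := boolP (z \in upset C).
    exact: upset_convex zU bC zb.
  have botN m : (a < m < b)%O -> p a != p m.
    move=> mI; apply/eqP => e; have := mem_pl m; rewrite mem_doubling_set.
    by rewrite (ma _ mI (esym e)) -e (negbTE aU).
  apply: (@contractible_conically R _ _ _ (fun m => g (p m) false) (g (p b) false)).
  - split=> [m|m m']; rewrite !memO => mI.
      have /andP[am' mb'] := bndm _ mI.
      by rewrite am ?mb ?Dz ?orbT ?botN.
    move=> mI' mm'; rewrite leE; have /andP[_ mb1] := bndm _ mI.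
    have /andP[_ mb2] := bndm _ mI'.
    have [-> ->] := gP _ _ (Dz _ mb1); have [-> ->] := gP _ _ (Dz _ mb2).
    by move: mm'; rewrite leE => /andP[->].
  - by rewrite memO am ?mb ?Dz ?orbT ?pN.
  - left=> m; rewrite memO => /bndm /andP[_ mb']; rewrite leE.
    by have [-> ->] := gP _ _ (Dz _ mb'); rewrite lexx.
  - left=> m; rewrite memO => /bndm /andP[_ mb']; rewrite leE.
    have [-> ->] := gP _ _ (Dz _ mb').
    by have [-> ->] := gP _ _ (Dz _ (lexx _)); rewrite mb'.
(* Neither end in [C]: raise an element to level 1 when this is possible,
   which gives a copy of the interval of [P]. *)
- have aU : p a \notin upset C by move: Da; rewrite (negbTE aC) orbF.
  have Dz z : ((z, z \in upset C) : P *p bool) \in doubling_set C.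
    by rewrite mem_doubling_set; case: (z \in upset C).
  apply: (@homotopy_contractible_or_spherical _ _ _ _ _ (open_interval (p a) (p b)));
    last exact: goodP.
  apply: (@order_homotopy_equivalent R _ _ _ _ _ _ p (fun z => g z (z \in upset C))).
  - split=> [m|m m' _ _]; last by rewrite leE => /andP[].
    rewrite memO inE => mI; have /andP[am' mb'] := bndm _ mI.
    rewrite !lt_neqAle am' mb' !andbT; apply/andP; split; apply/eqP => e.
      have := mem_pl m; rewrite mem_doubling_set.
      by rewrite (ma _ mI (esym e)) -e (negbTE aU).
    have := mem_pl m; rewrite mem_doubling_set.
    by rewrite (negbTE (mbl _ mI e)) e Db (negbTE bC).
  - split=> [z|z z' _ _ zz'].
      by rewrite inE memO => /andP[az zb]; rewrite am ?mb ?(ltW az) ?(ltW zb)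
        ?(lt_eqF az) ?(lt_eqF zb).
    rewrite leE; have [-> ->] := gP _ _ (Dz z); have [-> ->] := gP _ _ (Dz z').
    by rewrite zz'; apply/implyP => /upset_le; apply.
  - right=> m _ /=; rewrite leE; have [-> ->] := gP _ _ (Dz (p m)).
    rewrite lexx; apply/implyP => lm; have := mem_pl m.
    by rewrite lm mem_doubling_set.
  - by left=> z _ /=; have [->] := gP _ _ (Dz z).
Qed.

End Doubling.

Lemma doubling_spherical d (P : finPOrderType d) (C : {set P}) :
  order_convex C -> intervals_contractible_or_spherical P R ->
  intervals_contractible_or_spherical (doubling C) R.
Proof.
move=> Cc; apply: (@doubling_intervals _ P C _ (doubling C)
  (fun u : doubling C => (val u).1) (fun u : doubling C => (val u).2)) => //.
- by move=> a b; rewrite leEsub -prism_le -!surjective_pairing.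
- by case=> -[].
- move=> z b zb.
  by exists (exist (fun u => u \in doubling_set C) ((z, b) : P *p bool) zb).
Qed.

End Spherical.

(** * Congruences of a finite lattice *)

Section Congruences.
Variables (d : Order.disp_t) (L : finLatticeType d).
Implicit Types (E F : set (L * L)) (x y z a b : L).
Local Notation "x ⊓ y" := (Order.meet x y) (at level 48, left associativity).
Local Notation "x ⊔ y" := (Order.join x y) (at level 49, left associativity).

Section OneCongruence.
Variable E : set (L * L).
Hypothesis Ec : lattice_congruence E.

Lemma congr_refl x : E (x, x). Proof. by case: Ec. Qed.

Lemma congr_sym x y : E (x, y) -> E (y, x). Proof. by case: Ec => _ + _ _ _; apply. Qed.

Lemma congr_trans x y z : E (x, y) -> E (y, z) -> E (x, z).
Proof. by case: Ec => _ _ + _ _; apply. Qed.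

Lemma congr_meetr z x y : E (x, y) -> E (x ⊓ z, y ⊓ z).
Proof. by case: Ec => r _ _ + _ xy; apply => //; exact: r. Qed.

Lemma congr_joinr z x y : E (x, y) -> E (x ⊔ z, y ⊔ z).
Proof. by case: Ec => r _ _ _ + xy; apply => //; exact: r. Qed.

Lemma congr_convexr a b c : E (a, b) -> (a <= c <= b)%O -> E (c, b).
Proof.
move=> ab /andP[ac cb]; have := congr_joinr c ab.
by rewrite (join_r ac) (join_l cb).
Qed.

Lemma congr_meet_join x y : E (x ⊓ y, x ⊔ y) -> E (x, y).
Proof.
move=> xy; apply: (congr_trans (y := x ⊔ y)).
  by apply: (congr_convexr xy); rewrite leIl leUl.
by apply: congr_sym; apply: (congr_convexr xy); rewrite leIr leUr.
Qed.

End OneCongruence.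

Lemma Cg_congruence x y : lattice_congruence (Cg x y).
Proof.
split=> [z E [Ec _]|u v uv E EE|u v w uv vw E EE|u u' v v' uu vv E EE|u u' v v' uu vv E EE].
- exact: congr_refl.
- by have [Ec _] := EE; apply: congr_sym => //; exact: uv.
- by have [Ec _] := EE; apply: (congr_trans Ec (y := v)); [exact: uv|exact: vw].
- by have [[_ _ _ m _] _] := EE; apply: m; [exact: uu|exact: vv].
- by have [[_ _ _ _ j] _] := EE; apply: j; [exact: uu|exact: vv].
Qed.

Lemma Cg_mem x y : Cg x y (x, y).
Proof. by move=> E [_]; apply. Qed.

Lemma Cg_sub E x y : lattice_congruence E -> E (x, y) -> Cg x y `<=` E.
Proof. by move=> Ec xy p; apply; split=> // _ ->. Qed.

(** ** Joins of congruences *)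

Definition congr_join_step E F : rel L :=
  fun x y => `[< E (x, y) \/ F (x, y) >].

Definition congr_join E F : set (L * L) :=
  [set p | connect (congr_join_step E F) p.1 p.2].

Lemma connect_homo (e : rel L) (f : L -> L) x y :
  (forall u v, e u v -> connect e (f u) (f v)) ->
  connect e x y -> connect e (f x) (f y).
Proof.
move=> fe /connectP[s]; elim: s x => [|z s IH] x /=; first by move=> _ ->.
move=> /andP[xz zs] ey; apply: connect_trans (fe _ _ xz) _; exact: IH.
Qed.

Lemma congr_join_congruence E F : lattice_congruence E -> lattice_congruence F ->
  lattice_congruence (congr_join E F).
Proof.
move=> Ec Fc; pose e := congr_join_step E F.
have eC : connect_sym e.
  apply: sym_connect_sym => x y; apply/asboolP/asboolP;
    by move=> [xy|xy]; [left|right]; exact: congr_sym.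
have eM z x y : connect e x y -> connect e (x ⊓ z) (y ⊓ z).
  apply: (connect_homo (f := fun w => w ⊓ z)) => u v /asboolP uv.
  by apply/connect1/asboolP; case: uv => uv; [left|right]; exact: congr_meetr.
have eJ z x y : connect e x y -> connect e (x ⊔ z) (y ⊔ z).
  apply: (connect_homo (f := fun w => w ⊔ z)) => u v /asboolP uv.
  by apply/connect1/asboolP; case: uv => uv; [left|right]; exact: congr_joinr.
split=> [x|x y|x y z|x x' y y'|x x' y y']; rewrite /congr_join /=.
- exact: connect0.
- by rewrite eC.
- exact: connect_trans.
- move=> xx yy; apply: connect_trans (eM y _ _ xx) _.
  by rewrite !(meetC x'); exact: eM.
- move=> xx yy; apply: connect_trans (eJ y _ _ xx) _.
  by rewrite !(joinC x'); exact: eJ.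
Qed.

Lemma congr_joinl E F : E `<=` congr_join E F.
Proof. by move=> [x y] xy; apply/connect1/asboolP; left. Qed.

Lemma congr_joinr_sub E F : F `<=` congr_join E F.
Proof. by move=> [x y] xy; apply/connect1/asboolP; right. Qed.

Lemma covers_between a b z : covers a b -> (a <= z <= b)%O -> z = a \/ z = b.
Proof.
move=> [ab nab] /andP[az zb]; have [->|za] := eqVneq z a; first by left.
right; apply/eqP; have := nab z; rewrite !lt_neqAle az zb !andbT.
by rewrite eq_sym za /= negbK.
Qed.

(** Project the path from [a] to [b] into [a, b] by [z |-> (z ⊔ a) ⊓ b]. The
    projections take only the values [a] and [b], so some step leads from [a]
    to [b], and its congruence contains [(a, b)]. *)
Lemma congr_join_covers E F a b : lattice_congruence E -> lattice_congruence F ->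
  covers a b -> congr_join E F (a, b) -> E (a, b) \/ F (a, b).
Proof.
move=> Ec Fc ab /connectP[s /= + eb].
have ab_le : (a <= b)%O by case: ab => /ltW.
(* The projection onto the interval [a, b]. *)
pose f z := (z ⊔ a) ⊓ b.
have f01 z : f z = a \/ f z = b.
  by apply: covers_between ab _; rewrite leIr lexI leUr ab_le.
have fa : f a = a by rewrite /f joinxx; exact/meet_l.
have fb : f (last a s) = b by rewrite -eb /f (join_l ab_le) meetxx.
suff H x : f x = a -> f (last x s) = b -> path (congr_join_step E F) x s ->
    E (a, b) \/ F (a, b) by exact: H.
elim: s x {eb fb} => [|z s IH] x /= fx fb.
  by case: ab; rewrite -fx -fb ltxx.
move=> /andP[/asboolP xz zs]; case: (f01 z) => fz; first exact: IH zs.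
have step G : lattice_congruence G -> G (x, z) -> G (a, b).
  by move=> Gc Gxz; rewrite -fx -fz; apply: congr_meetr => //; exact: congr_joinr.
by case: xz => [/(step E Ec)|/(step F Fc)]; [left|right].
Qed.

(** ** Irreducible elements detecting a pair of congruences *)

(** Take [j] minimal among the elements below [x] with [(j ⊓ v, j)] outside
    [E]. Elements strictly below [j] are [E]-related to their meets with [v],
    hence so is any join of such elements, and [j] is not one. The lower cover
    of [j] is at least [j ⊓ v], which puts the cover in [F], and it is
    [E]-related to its meet with [v], which keeps the cover outside [E]. *)
Lemma join_irreducible_detect E F v x :
  lattice_congruence E -> lattice_congruence F ->
  (v <= x)%O -> F (v, x) -> ~ E (v, x) ->
  exists jl j, [/\ join_irreducible j, covers jl j, (j <= x)%O, F (jl, j) &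
                   ~ E (jl, j)].
Proof.
move=> Ec Fc vx Fvx nEvx.
pose bad j := (j <= x)%O && `[< ~ E (j ⊓ v, j) >].
have badx : bad x by rewrite /bad lexx (meet_r vx); apply/asboolP.
pose down j := #|[set z : L | (z < j)%O]%SET|.
case: (arg_minnP down badx) => j /andP[jx /asboolP nEj] jmin.
have below a : (a < j)%O -> E (a ⊓ v, a).
  move=> aj; apply: contrapT => nEa.
  have abad : bad a by rewrite /bad (le_trans (ltW aj) jx); apply/asboolP.
  have := jmin a abad; rewrite leqNgt => /negP; apply.
  apply: proper_card; apply/properP; split.
    by apply/fintype.subsetP => z; rewrite !inE => /lt_trans; apply.
  by exists a; rewrite inE ?ltxx.
have jv_lt : (j ⊓ v < j)%O.
  rewrite lt_neqAle leIl andbT; apply/eqP => e; apply: nEj; rewrite e.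
  exact: congr_refl.
have ji a b : j = a ⊔ b -> j = a \/ j = b.
  move=> jab; apply: contrapT => /not_orP[ja jb]; apply: nEj.
  have aj : (a < j)%O by rewrite lt_neqAle {2}jab leUl andbT; apply/eqP => /esym.
  have bj : (b < j)%O by rewrite lt_neqAle {2}jab leUr andbT; apply/eqP => /esym.
  have Eab : E ((a ⊓ v) ⊔ (b ⊓ v), j).
    by case: (Ec) => _ _ _ _ h; rewrite jab; apply: h; exact: below.
  apply: (congr_convexr Ec Eab); rewrite leIl andbT leUx !lexI.
  by rewrite !leIr !andbT !(le_trans (leIl _ _)) // ltW.
(* The unique lower cover of [j] is the join of everything strictly below
   [j]. There is no distinguished bottom to start the join from, so it
   starts from [j ⊓ v]. *)
pose jl := \big[Order.join/(j ⊓ v)]_(a | (a < j)%O) a.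
have jl_lt : (jl < j)%O.
  rewrite /jl; elim/big_ind: _ => // a b aj bj.
  rewrite lt_neqAle leUx (ltW aj) (ltW bj) !andbT; apply/eqP => e.
  by case: (ji _ _ (esym e)) => e'; [move: aj|move: bj]; rewrite -e' ltxx.
have jl_max a : (a < j)%O -> (a <= jl)%O.
  by move=> aj; rewrite /jl (bigD1 a) //= leUl.
have jl_cov : covers jl j.
  split=> // z; apply/negP => /andP[jlz zj].
  by have := lt_le_trans jlz (jl_max _ zj); rewrite ltxx.
exists jl, j; split=> //.
- by split=> //; exists jl.
- have Fj : F (j ⊓ v, j).
    have := congr_meetr Fc j Fvx.
    by rewrite [v ⊓ j]meetC (meet_r jx).
  by apply: (congr_convexr Fc Fj); rewrite jl_max //= ltW.
- move=> Ejl; apply: nEj; have Ejv := congr_trans Ec (below _ jl_lt) Ejl.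
  apply: (congr_convexr Ec Ejv); rewrite leIl andbT lexI leIr andbT.
  exact: le_trans (leIl _ _) (ltW jl_lt).
Qed.

End Congruences.

(** The dual of the preceding lemma, applied to the dual lattice. *)
Lemma meet_irreducible_detect d (L : finLatticeType d) (E F : set (L * L)) (v x : L) :
  lattice_congruence E -> lattice_congruence F ->
  (v <= x)%O -> F (v, x) -> ~ E (v, x) ->
  exists m ms, [/\ meet_irreducible m, covers m ms, (v <= m)%O, F (m, ms) &
                   ~ E (m, ms)].
Proof.
move=> Ec Fc vx Fvx nEvx.
have dualc (G : set (L * L)) : lattice_congruence G ->
    lattice_congruence (G : set (L^d * L^d)).
  by case=> r s t m j; split.
have [ms [m [mi [mm nmm] vm Fm nEm]]] := join_irreducible_detect (L := L^d) (v := x) (x := v)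
  (dualc _ Ec) (dualc _ Fc) vx (congr_sym Fc Fvx)
  (fun h => nEvx (congr_sym Ec h)).
exists m, ms; split=> //.
- split=> [//|z]; apply/negP => /andP[mz zms].
  by have /negP := nmm z; apply; apply/andP; split.
- exact: (congr_sym Fc Fm).
- by move=> Em; exact: nEm (congr_sym Ec Em).
Qed.

(** * Congruence-normal lattices *)

Section Subposet.
Variables (d : Order.disp_t) (P : finPOrderType d).

Definition subposet (A : {set P}) : Type := {x : P | x \in A}.

End Subposet.

HB.instance Definition _ d (P : finPOrderType d) (A : {set P}) :=
  SubFinite.on (subposet A).
HB.instance Definition _ d (P : finPOrderType d) (A : {set P}) :=
  [SubChoice_isSubPOrder of subposet A by <: with d].

Section Bottoms.
Variables (d : Order.disp_t) (L : finLatticeType d).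
Implicit Types (E F : set (L * L)) (x y z a b : L).
Local Notation "x ⊓ y" := (Order.meet x y) (at level 48, left associativity).
Local Notation "x ⊔ y" := (Order.join x y) (at level 49, left associativity).

(** The least elements of the classes: an order-isomorphic copy of the
    quotient of [L] by [E]. *)
Definition bottoms E : {set L} :=
  [set x : L | `[< forall y, E (x, y) -> (x <= y)%O >]]%SET.

Lemma bottomsP E x : reflect (forall y, E (x, y) -> (x <= y)%O) (x \in bottoms E).
Proof. by rewrite inE; exact: asboolP. Qed.

Lemma bottom_exists E : lattice_congruence E ->
  exists pi : L -> L, forall x, pi x \in bottoms E /\ E (x, pi x).
Proof.
move=> Ec; suff /choice[pi piP] : forall x, exists y, y \in bottoms E /\ E (x, y).
  by exists pi.
move=> x; pose down j := #|[set z : L | (z < j)%O]%SET|.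
have xx : `[< E (x, x) >] by apply/asboolP; exact: congr_refl.
case: (arg_minnP (P := fun y => `[< E (x, y) >]) down xx) => y /asboolP xy ymin.
exists y; split=> //; apply/bottomsP => z yz.
have yzy : (y ⊓ z <= y)%O by exact: leIl.
have Eyz : E (x, y ⊓ z).
  apply: (congr_trans Ec xy); have := congr_meetr Ec y yz.
  by rewrite meetxx meetC.
have [<-|ne] := eqVneq (y ⊓ z) y; first exact: leIr.
have lt : (y ⊓ z < y)%O by rewrite lt_neqAle ne.
have /ymin : `[< E (x, y ⊓ z) >] by exact/asboolP.
rewrite leqNgt => /negP[]; apply: proper_card; apply/properP; split.
  by apply/fintype.subsetP => w; rewrite !inE => /lt_trans; apply.
by exists (y ⊓ z); rewrite inE ?ltxx.
Qed.

Lemma bottoms_eq E x y : lattice_congruence E ->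
  x \in bottoms E -> y \in bottoms E -> E (x, y) -> x = y.
Proof.
move=> Ec /bottomsP xb /bottomsP yb xy; apply: le_anti; rewrite xb //=.
by apply: yb; exact: congr_sym.
Qed.

Section Step.
Variables (E F gamma : set (L * L)).
Hypotheses (Ec : lattice_congruence E) (Fc : lattice_congruence F).
Hypothesis EF : E `<=` F.
Hypothesis EF_covers : forall a b, covers a b -> F (a, b) -> ~ E (a, b) ->
  Cg a b = gamma.
Hypothesis L_normal : congruence_normal L.

(** Otherwise a join-irreducible [j <= w1] and a meet-irreducible [m >= v2],
    both generating [gamma], satisfy [j <= m]. *)
Lemma step_not_le v1 w1 v2 w2 : (v1 <= w1)%O -> (v2 <= w2)%O ->
  F (v1, w1) -> ~ E (v1, w1) -> F (v2, w2) -> ~ E (v2, w2) -> ~ (w1 <= v2)%O.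
Proof.
move=> vw1 vw2 F1 nE1 F2 nE2 w1v2.
have [jl [j [jP jc jw Fj nEj]]] := join_irreducible_detect Ec Fc vw1 F1 nE1.
have [m [ms [mP mc vm Fm nEm]]] := meet_irreducible_detect Ec Fc vw2 F2 nE2.
have /negP := L_normal mP mc jP jc (etrans (EF_covers mc Fm nEm)
  (esym (EF_covers jc Fj nEj))).
by apply; exact: le_trans jw (le_trans w1v2 vm).
Qed.

(** Otherwise the pairs [(v, w)] and [(w, w ⊔ x)] contradict [step_not_le]. So
    in the quotient by [E] the element [w] is the top of its class under [F].
    *)
Lemma step_top v w x : (v <= w)%O -> F (v, w) -> ~ E (v, w) -> F (w, x) ->
  E (w, w ⊔ x).
Proof.
move=> vw Fvw nEvw Fwx; apply: contrapT => nE.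
have Fwwx : F (w, w ⊔ x).
  by have := congr_joinr Fc w Fwx; rewrite joinxx joinC.
exact: (step_not_le vw (leUl w x) Fvw nEvw Fwwx nE (lexx w)).
Qed.

(** The quotient by [E] is the doubling of the quotient by [F] at the set of
    those classes of [F] that contain more than one class of [E]. *)
Lemma step_intervals (R : realType) :
  intervals_contractible_or_spherical (subposet (bottoms F)) R ->
  intervals_contractible_or_spherical (subposet (bottoms E)) R.
Proof.
have [piE piEP] := bottom_exists Ec; have [piF piFP] := bottom_exists Fc.
pose M := subposet (bottoms E); pose P := subposet (bottoms F).
have bFE x : x \in bottoms F -> x \in bottoms E.
  by move=> /bottomsP xF; apply/bottomsP => y /EF /xF.
pose p (m : M) : P :=
  exist (fun x => x \in bottoms F) (piF (val m)) (piFP (val m)).1.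
pose C : {set P} := [set v : P | `[< exists w : L,
  [/\ w \in bottoms E, F (val v, w) & w != val v] >]]%SET.
have CP (v : P) : reflect (exists w : L, [/\ w \in bottoms E, F (val v, w) & w != val v])
    (v \in C).
  by rewrite inE; exact: asboolP.
(* Level 1 holds the tops of the classes that split, and the classes above
   [C] that do not. *)
pose lev (m : M) := (val (p m) != val m) || (p m \in upset C :\: C).
have Fp (m : M) : F (val (p m), val m) by apply: congr_sym => //; exact: (piFP _).2.
have p_le (m : M) : (val (p m) <= val m)%O.
  by have /bottomsP := (piFP (val m)).1; apply; exact: Fp.
have nE_ne x y : x \in bottoms E -> y \in bottoms E -> x != y -> ~ E (x, y).
  by move=> xE yE /eqP xy Exy; apply: xy; exact: bottoms_eq Exy.
have M_bot (m : M) : val m \in bottoms E by case: m.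
have P_bot (v : P) : val v \in bottoms F by case: v.
have nEp (m : M) : val (p m) != val m -> ~ E (val (p m), val m).
  by apply: nE_ne => //; exact: bFE.
have notC (v : P) w : v \notin C -> w \in bottoms E -> F (val v, w) -> w = val v.
  move=> vC wE Fvw; apply/eqP; apply: contraNT vC => wv.
  by apply/CP; exists w.
have p_mono (m m' : M) : (m <= m')%O -> (p m <= p m')%O.
  rewrite !leEsub => mm'.
  have Fm : F (val (p m) , val m ⊓ val (p m')).
    apply: (congr_trans Fc (Fp m)); have := congr_meetr Fc (val m) (Fp m').
    rewrite (meet_r mm') meetC.
    exact: congr_sym.
  have /bottomsP /(_ _ Fm) := P_bot (p m).
  by move=> /le_trans; apply; exact: leIr.
have C_witness (v : P) : v \in C -> exists w : L,
    [/\ w \in bottoms E, (val v <= w)%O, F (val v, w) & ~ E (val v, w)].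
  move=> /CP[w [wE Fvw wv]]; exists w; split=> //.
    by have /bottomsP := P_bot v; apply.
  by apply: nE_ne => //; [exact: bFE|rewrite eq_sym].
have pC (m : M) : val (p m) != val m -> p m \in C.
  by move=> pm; apply/CP; exists (val m); rewrite eq_sym.
have C_convex : order_convex C.
  move=> v1 v2 v /C_witness[w1 [w1E vw1 F1 nE1]] /C_witness[w2 [w2E vw2 F2 nE2]].
  rewrite !leEsub => /andP[v1v vv2]; apply: contrapT => /negP vC.
  have Fvw : F (val v, val v ⊔ w1).
    by have := congr_joinr Fc (val v) F1; rewrite (join_r v1v) joinC.
  have [uE Eu] := piEP (val v ⊔ w1).
  have u_v : piE (val v ⊔ w1) = val v.
    by apply: notC => //; apply: (congr_trans Fc Fvw); exact: EF.
  rewrite u_v in Eu.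
  (* The class of [v] does not split, so modulo [E] the element [w1] is
     below [v], hence below [v2]; raising the second pair by [w1] then
     contradicts [step_not_le]. *)
  have E2 : E (val v2 ⊔ w1, val v2).
    have := congr_joinr Ec (val v2) Eu.
    by rewrite (join_r vv2) joinAC (join_r vv2).
  apply: (@step_not_le (val v1) w1 (val v2 ⊔ w1) (w2 ⊔ w1)) => //.
  - by rewrite leUx leUr andbT (le_trans vw2) // leUl.
  - exact: congr_joinr.
  - move=> Evw; apply: nE2; apply: (congr_trans Ec (congr_sym Ec E2)).
    apply: (congr_trans Ec Evw).
    have := congr_joinr Ec w2 E2; rewrite (join_r vw2) joinAC (join_r vw2).
    by [].
  - exact: leUr.
apply: (@doubling_intervals R _ P C _ M p lev) => //.
- move=> m m'; apply/idP/andP => [mm'|[pp /implyP ll]].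
    split; first exact: p_mono.
    have pp := p_mono _ _ mm'; apply/implyP => lm.
    have pU : p m' \in upset C.
      apply: upset_le pp; case/orP: lm => [/pC /sub_upset //|].
      by rewrite finset.in_setD => /andP[].
    apply: contrapT => /negP; rewrite negb_or negbK finset.in_setD pU andbT negbK.
    move=> /andP[/eqP pm' pC'].
    have [w2 [_ vw2 F2 nE2]] := C_witness _ pC'.
    case/orP: lm => [pm|].
      apply: (step_not_le (p_le m) vw2 (Fp m) (nEp _ pm) F2 nE2).
      by rewrite pm' -leEsub.
    rewrite finset.in_setD => /andP[/negP npC pU']; apply: npC.
    exact: upset_convex C_convex pU' pC' pp.
  rewrite leEsub; rewrite leEsub in pp.
  have [pm|pm] := eqVneq (val (p m)) (val m).
    by rewrite -pm; exact: le_trans pp (p_le m').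
  have lm' : lev m' by apply: ll; rewrite /lev pm.
  have Fmm' : F (val m', val m ⊔ val m').
    have := congr_joinr Fc (val m') (Fp m).
    by rewrite (join_r (le_trans pp (p_le m'))).
  have Emm' : E (val m', val m ⊔ val m').
    case/orP: lm' => [pm'|].
      have := step_top (p_le m') (Fp m') (nEp _ pm') Fmm'.
      by rewrite joinCA joinxx.
    rewrite finset.in_setD => /andP[pC' _].
    have [uE Eu] := piEP (val m ⊔ val m').
    have u_p : piE (val m ⊔ val m') = val (p m').
      apply: notC => //; apply: (congr_trans Fc (Fp m')).
      by apply: (congr_trans Fc Fmm'); exact: EF.
    rewrite u_p in Eu; apply: (congr_convexr Ec (congr_sym Ec Eu)).
    by rewrite p_le leUr.
  have Em : E (val m, val m ⊓ val m').
    have := congr_meetr Ec (val m) Emm'.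
    rewrite (meet_r (leUl _ _)) meetC.
    exact: congr_sym.
  have /bottomsP /(_ _ Em) := M_bot m.
  by move=> /le_trans; apply; exact: leIr.
- move=> m; rewrite mem_doubling_set; case: ifP => [/orP[/pC /sub_upset //|]|].
    by rewrite finset.in_setD => /andP[].
  move=> /negbT; rewrite negb_or finset.in_setD negb_and !negbK => /andP[_].
  by rewrite orbC.
- move=> z b; rewrite mem_doubling_set => zb.
  have zE := bFE _ (P_bot z).
  pose mz : M := exist (fun x => x \in bottoms E) (val z) zE.
  have pz (m : M) : F (val z, val m) -> p m = z.
    move=> Fz; apply: val_inj; apply: (bottoms_eq Fc) => //.
    by apply: (congr_trans Fc (Fp m)); exact: congr_sym.
  have pmz : p mz = z by apply: pz; exact: congr_refl.
  have [zC|zC] := boolP (z \in C); case: b zb => zb.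
  + have [w [wE zw Fw nE]] := C_witness _ zC.
    exists (exist (fun x => x \in bottoms E) w wE : M).
    have pw : p (exist (fun x => x \in bottoms E) w wE : M) = z by exact: pz.
    split=> //; rewrite /lev pw; apply/orP; left => /=.
    by apply/eqP => zw'; apply: nE; rewrite -zw'; exact: congr_refl.
  + by exists mz; split=> //; rewrite /lev pmz eqxx finset.in_setD zC.
  + by exists mz; split=> //; rewrite /lev pmz eqxx finset.in_setD zC zb.
  + exists mz; split=> //; rewrite /lev pmz eqxx finset.in_setD zC /=.
    by move: zb; rewrite (negbTE zC) orbF => /negbTE.
Qed.

End Step.
End Bottoms.

Section CongruenceNormal.
Variables (R : realType) (d : Order.disp_t) (L : finLatticeType d).
Implicit Types (E F : set (L * L)) (x y z a b : L).
Local Notation "x ⊓ y" := (Order.meet x y) (at level 48, left associativity).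
Local Notation "x ⊔ y" := (Order.join x y) (at level 49, left associativity).

(** A pair [a <= b] outside [E] with the fewest elements between is a cover.
    *)
Lemma covers_outside E x y : lattice_congruence E -> ~ E (x, y) ->
  exists a b, covers a b /\ ~ E (a, b).
Proof.
move=> Ec nExy.
pose bad (u : L * L) := (u.1 <= u.2)%O && `[< ~ E u >].
have badxy : bad (x ⊓ y, x ⊔ y).
  rewrite /bad (le_trans (leIl _ _) (leUl _ _)); apply/asboolP => Exy.
  by apply: nExy; exact: congr_meet_join.
pose len (u : L * L) := #|[set z | (u.1 <= z <= u.2)%O]%SET|.
case: (arg_minnP len badxy) => -[a b] /andP[/= ab /asboolP nEab] abmin.
(* A proper subinterval has fewer elements. *)
have shorter u v : (a <= u)%O -> (u <= v)%O -> (v <= b)%O ->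
    (a != u) || (v != b) -> E (u, v).
  move=> au uv vb ne; apply: contrapT => nE.
  have /abmin : bad (u, v) by rewrite /bad /= uv; apply/asboolP.
  rewrite leqNgt => /negP[]; apply: proper_card; apply/properP; split.
    apply/fintype.subsetP => z; rewrite !inE /= => /andP[uz zv].
    by rewrite (le_trans au uz) (le_trans zv vb).
  case/orP: ne => ne; [exists a|exists b]; rewrite !inE /= ?lexx ?ab //.
    by apply: contra ne => /andP[ua _]; rewrite eq_le au.
  by apply: contra ne => /andP[_ bv]; rewrite eq_le vb.
exists a, b; split=> //; split=> [|z].
  rewrite lt_neqAle ab andbT; apply/eqP => e; apply: nEab; rewrite e.
  exact: congr_refl.
apply/negP => /andP[az zb]; apply: nEab; apply: (congr_trans Ec (y := z)).
  by apply: shorter; rewrite ?lexx ?ltW // (lt_eqF zb) orbT.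
by apply: shorter; rewrite ?lexx ?ltW // (lt_eqF az).
Qed.

(** By induction on the number of pairs outside [E]; in the quotient by the
    full congruence there are no intervals. *)
Lemma bottoms_intervals E : congruence_normal L -> lattice_congruence E ->
  intervals_contractible_or_spherical (subposet (bottoms E)) R.
Proof.
move=> Ln; pose outside E := #|[set u : L * L | `[< ~ E u >]]%SET|.
have [n] := ubnP (outside E); elim: n E => // n IH E En Ec.
have [[x [y nExy]]|full] := pselect (exists x y, ~ E (x, y)); last first.
  move=> x y xy; exfalso; have Exy : E (val x, val y).
    by apply: contrapT => nE; apply: full; exists (val x), (val y).
  have e : x = y by apply: val_inj; apply: (bottoms_eq Ec) Exy; exact: valP.
  by rewrite e ltxx in xy.
pose card_Cg (u : L * L) := #|[set v : L * L | `[< Cg u.1 u.2 v >]]%SET|.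
pose bad (u : L * L) := `[< covers u.1 u.2 /\ ~ E u >].
have [a0 [b0 ab0]] := covers_outside Ec nExy.
have bad0 : bad (a0, b0) by apply/asboolP.
case: (arg_minnP card_Cg bad0) => -[a b] /asboolP[/= abc nEab] abmin.
have Gc := Cg_congruence a b.
have Fc := congr_join_congruence Ec Gc.
apply: (step_intervals (gamma := Cg a b) Ec Fc (@congr_joinl _ _ _ _)) => //.
  move=> u v uvc Fuv nEuv.
  have Guv : Cg a b (u, v) by case: (congr_join_covers Ec Gc uvc Fuv).
  have sub_t t : Cg u v t -> Cg a b t by exact: Cg_sub.
  apply/seteqP; split=> [w /sub_t //|w Gw]; apply: contrapT => nw.
  have /abmin : bad (u, v) by apply/asboolP.
  rewrite leqNgt => /negP[]; apply: proper_card; apply/properP; split.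
    by apply/fintype.subsetP => t; rewrite !finset.in_set => /asboolP /= tG; apply/asboolP; exact: sub_t.
  by exists w; rewrite finset.in_set; [exact/asboolP|apply/asboolP].
apply: IH => //; rewrite -ltnS; apply: leq_trans En; rewrite ltnS.
apply: proper_card; apply/properP; split.
  apply/fintype.subsetP => t; rewrite !finset.in_set => /asboolP nF; apply/asboolP => Et.
  by apply: nF; exact: congr_joinl.
exists (a, b); rewrite finset.in_set; first exact/asboolP.
by apply/asboolP => h; apply: h; apply: congr_joinr_sub; exact: Cg_mem.
Qed.

(** The quotient by equality is [L], and a doubling at the empty set changes
    nothing. *)
Lemma congruence_normal_intervals : congruence_normal L ->
  intervals_contractible_or_spherical L R.
Proof.
move=> Ln; pose E0 := [set u : L * L | u.1 = u.2].
have E0c : lattice_congruence E0.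
  split=> [x|x y|x y z|x x' y y'|x x' y y'] //; rewrite /E0 /=.
  - by move=> ->.
  - by move=> -> ->.
  - by move=> -> ->.
have b0 x : x \in bottoms E0 by apply/bottomsP => y; rewrite /E0 /= => ->.
have U0 : upset (finset.set0 : {set subposet (bottoms E0)}) = finset.set0.
  apply/finset.setP => z; rewrite !inE; apply/existsP => -[c].
  by rewrite finset.in_set0.
apply: (@doubling_intervals R _ (subposet (bottoms E0)) finset.set0 _ L
  (fun x => exist (fun x => x \in bottoms E0) x (b0 x)) (fun=> false)).
- by move=> x y z; rewrite finset.in_set0.
- by move=> x y; rewrite leEsub andbT.
- by move=> x; rewrite mem_doubling_set U0 finset.in_set0.
- move=> z [|]; rewrite mem_doubling_set U0 finset.in_set0 // => _.
  by exists (val z); split=> //; exact: val_inj.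
- exact: bottoms_intervals.
Qed.

End CongruenceNormal.

Theorem corollary6p3 (R : realType) (d : Order.disp_t) (L : finLatticeType d) :
  (forall C : {set L}, order_convex C ->
     intervals_contractible_or_spherical L R ->
     intervals_contractible_or_spherical (doubling C) R) /\
  (congruence_normal L -> intervals_contractible_or_spherical L R).
Proof.
split=> [C|]; first exact: doubling_spherical.
exact: congruence_normal_intervals.
Qed.
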